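(* Assume $r+s=2$, and let $T=-T_{\mathfrak p}Q|_{\mathfrak p}+T_1Q|_{\mathfrak k_1}+T_2Q|_{\mathfrak k_2}$ with $T_{\mathfrak p},T_1,T_2>0$. Set $$a=nd_2(1-\kappa_2)T_{\mathfrak p},\qquad b=d_1^2(1-\kappa_1)T_1-d_2^2(1-\kappa_2)T_2+2n^2T_{\mathfrak p}-\frac{n^2\kappa_1T_{\mathfrak p}^2}{T_1},$$ $$c=-2nd_2T_2+\frac{2nd_2\kappa_1T_{\mathfrak p}T_2}{T_1}-nd_2\kappa_2T_{\mathfrak p},\qquad d=-\frac{d_2^2\kappa_1T_2^2}{T_1}+\kappa_2d_2^2T_2,$$ $D=18abcd-4b^3d+b^2c^2-4ac^3-27a^2d^2$, $R_t=-\frac{b}{3a}$, and, when $b^2\ne3ac$, $R_d=\frac{9ad-bc}{2(b^2-3ac)}$ and $R_s=\frac{4abc-9a^2d-b^3}{a(b^2-3ac)}$. Then $S|_{\mathcal M_T^0}$ does not attain a global minimum, and: (1) $S|_{\mathcal M_T^0}$ has a saddle point if and only if $D=0$, $b^2=3ac$ and $\frac{d_2T_2}{nT_{\mathfrak p}}<R_t$; (2) $S|_{\mathcal M_T^0}$ attains a global maximum if and only if $D=0$, $b^2\ne3ac$ and $R_s\le\frac{d_2T_2}{nT_{\mathfrak p}}<R_d$; (3) $S|_{\mathcal M_T^0}$ has a local maximum that is not a global maximum if and only if $D=0$, $b^2\ne3ac$ and $\frac{d_2T_2}{nT_{\mathfrak p}}<R_s<R_d$; (4) $S|_{\mathcal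 M_T^0}$ has a local minimum if and only if $D=0$, $b^2\ne3ac$ and $\frac{d_2T_2}{nT_{\mathfrak p}}<R_d<R_s$. Moreover, whenever a critical point of $S|_{\mathcal M_T^0}$ exists, it is unique up to scaling.
   Context: Let $G$ be a connected non-compact simple Lie group with Lie algebra $\mathfrak g$, $K$ a maximal compact subgroup with Lie algebra $\mathfrak k$, $B$ the Killing form of $\mathfrak g$, and $\mathfrak p$ the $B$-orthogonal complement of $\mathfrak k$ in $\mathfrak g$. Let $Q=B|_{\mathfrak p}-B|_{\mathfrak k}$. Write $\mathfrak k=\mathfrak k_1\oplus\cdots\oplus\mathfrak k_{r+s}$, where $\mathfrak k_1,\dots,\mathfrak k_r$ are the simple ideals of $[\mathfrak k,\mathfrak k]$, $\mathfrak k_{r+1}$ is the centre of $\mathfrak k$, and $s=1$ if the centre is nontrivial, $s=0$ otherwise. Let $n=\dim\mathfrak p$, $d_i=\dim\mathfrak k_i$, and define $\kappa_i$ by $B_i=\kappa_iB|_{\mathfrak k_i}$, $B_i$ the Killing form of $\mathfrak k_i$. Left-invariant tensor fields on $G$ are identified with bilinear forms on $\mathfrak g$; $Q|_{\mathfrak u}$ denotes $Q$ restricted to $\mathfrak u$ and extended by zero on its $Q$-orthogonal complement. $\mathcal M_K$ is the set of left-invariant metrics on $G$ naturally reductive with respect to $G\times K$ (acting by $(x,k)y=xyk^{-1}$), which by a theorem of Gordon are exactly the metrics $\beta Q|_{\mathfrak p}+\sum_i\alpha_iQ|_{\mathfrak k_i}$ with $\beta,\alpha_i>0$; it is a manifold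 via these parameters. $S$ is the scalar curvature functional, and $\mathcal M_T^0=\{g\in\mathcal M_K:\mathrm{tr}_gT=0\}$ with the induced manifold structure. A saddle point means a critical point that is neither a local maximum nor a local minimum. *)

(* Defs.v *)
From HB Require Import structures.
From mathcomp Require Import all_boot all_order all_algebra.
From mathcomp Require Import all_classical all_reals all_analysis.
Set Implicit Arguments. Unset Strict Implicit. Unset Printing Implicit Defensive.
Import Order.TTheory GRing.Theory Num.Theory.
Local Open Scope ring_scope.

Section LieDefs.
Variables (R : realType) (N : nat).

Definition ev (i : 'I_N) : 'rV[R]_N := delta_mx 0 i.

(* structure constants: c i j = [e_i, e_j]; bracket extended bilinearly *)
Definition lbr (c : 'I_N -> 'I_N -> 'rV[R]_N) (x y : 'rV[R]_N) : 'rV[R]_N :=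
  \sum_i \sum_j (x 0 i * y 0 j) *: c i j.

Definition is_lie_algebra (c : 'I_N -> 'I_N -> 'rV[R]_N) : Prop :=
  (forall x y, lbr c x y = - lbr c y x) /\
  (forall x y z, lbr c x (lbr c y z) + lbr c y (lbr c z x) + lbr c z (lbr c x y) = 0).

(* matrix of ad_x acting on row vectors: y *m adm c x = [x, y] *)
Definition adm c (x : 'rV[R]_N) : 'M[R]_N := \matrix_(i, j) (lbr c x (ev i)) 0 j.

Definition killing c (x y : 'rV[R]_N) : R := \tr (adm c x *m adm c y).

Definition simple_lie c : Prop :=
  (exists x y, lbr c x y != 0) /\
  forall U : {vspace 'rV[R]_N},
    (forall x y, x \in U -> lbr c y x \in U) -> U = 0%VS \/ U = fullv.

Definition gram (f : 'rV[R]_N -> 'rV[R]_N -> R) : 'M[R]_N :=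
  \matrix_(i, j) f (ev i) (ev j).

Definition gf (G : 'M[R]_N) (x y : 'rV[R]_N) : R := (x *m G *m y^T) 0 0.

Definition trform (G T : 'M[R]_N) : R := \sum_i \sum_j invmx G i j * T i j.

(* Levi-Civita connection of the left-invariant metric G on left-invariant
   fields, via the Koszul formula
     2 g(nabla_X Y, Z) = g([X,Y],Z) - g([Y,Z],X) + g([Z,X],Y). *)
Definition koszul c G (X Y Z : 'rV[R]_N) : R :=
  (gf G (lbr c X Y) Z - gf G (lbr c Y Z) X + gf G (lbr c Z X) Y) / 2%:R.

Definition lcnabla c G (X Y : 'rV[R]_N) : 'rV[R]_N :=
  \sum_k \sum_l (koszul c G X Y (ev k) * invmx G k l) *: ev l.

Definition curv c G (X Y Z : 'rV[R]_N) : 'rV[R]_N :=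
  lcnabla c G X (lcnabla c G Y Z) - lcnabla c G Y (lcnabla c G X Z)
  - lcnabla c G (lbr c X Y) Z.

(* Ric(Y,Z) = tr (X |-> R(X,Y)Z) *)
Definition ricci c G (Y Z : 'rV[R]_N) : R :=
  \sum_i \sum_k invmx G i k * gf G (curv c G (ev i) Y Z) (ev k).

Definition scal c G : R := \sum_j \sum_l invmx G j l * ricci c G (ev j) (ev l).

Definition inSub (P : pred 'I_N) (x : 'rV[R]_N) : Prop :=
  forall j, ~~ P j -> x 0 j = 0.

Definition prj (P : pred 'I_N) (x : 'rV[R]_N) : 'rV[R]_N :=
  \row_j (if P j then x 0 j else 0).

Definition simple_sub c (P : pred 'I_N) : Prop :=
  (exists x y, inSub P x /\ inSub P y /\ lbr c x y != 0) /\
  forall U : {vspace 'rV[R]_N},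
    (forall x, x \in U -> inSub P x) ->
    (forall x y, x \in U -> inSub P y -> lbr c y x \in U) ->
    U = 0%VS \/ (forall x, inSub P x -> x \in U).

(* Killing form of the (ad-invariant) subalgebra spanned by coordinates P *)
Definition killing_sub c (P : pred 'I_N) (x y : 'rV[R]_N) : R :=
  \sum_(j | P j) (lbr c x (lbr c y (ev j))) 0 j.

End LieDefs.

(* The setting: g = p (+) k_1 (+) k_2 in an adapted basis of R^(n+d1+d2):    *)
(* coordinates [0,n) span p, [n,n+d1) span k_1, [n+d1,n+d1+d2) span k_2.    *)
Section Setting.
Variables (R : realType) (n d1 d2 : nat).
Local Notation N := (n + d1 + d2)%N.

Definition pP : pred 'I_N := fun i => (i < n)%N.
Definition k1P : pred 'I_N := fun i => (n <= i)%N && (i < n + d1)%N.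
Definition k2P : pred 'I_N := fun i => (n + d1 <= i)%N.
Definition kP : pred 'I_N := fun i => (n <= i)%N.

Variable c : 'I_N -> 'I_N -> 'rV[R]_N.

(* k is the Lie algebra of a maximal compact subgroup K and p its
   B-orthogonal complement: Cartan decomposition g = k (+) p. *)
Definition cartan_decomposition : Prop :=
  (forall x y, inSub kP x -> inSub kP y -> inSub kP (lbr c x y)) /\
  (forall x y, inSub kP x -> inSub pP y -> inSub pP (lbr c x y)) /\
  (forall x y, inSub pP x -> inSub pP y -> inSub kP (lbr c x y)) /\
  (forall x y, inSub kP x -> inSub pP y -> killing c x y = 0) /\
  (forall x, inSub kP x -> x != 0 -> killing c x x < 0) /\
  (forall x, inSub pP x -> x != 0 -> 0 < killing c x x).

Definition ideal_of_k (P : pred 'I_N) : Prop :=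
  forall x y, inSub P x -> inSub kP y -> inSub P (lbr c y x).

(* r + s = 2: either k = k_1 (+) k_2 with k_1, k_2 simple (r = 2, s = 0), or
   k = k_1 (+) z(k) with k_1 = [k,k] simple and k_2 = z(k) <> 0 (r = 1, s = 1) *)
Definition k_decomposition_rs2 : Prop :=
  ideal_of_k k1P /\ ideal_of_k k2P /\
  ((simple_sub c k1P /\ simple_sub c k2P) \/
   (simple_sub c k1P /\ (0 < d2)%N /\
    forall x, inSub kP x ->
      ((forall y, inSub kP y -> lbr c x y = 0) <-> inSub k2P x))).

Definition kappa_of (P : pred 'I_N) (kap : R) : Prop :=
  forall x y, inSub P x -> inSub P y -> killing_sub c P x y = kap * killing c x y.

Definition Qform (x y : 'rV[R]_N) : R :=
  killing c (prj pP x) (prj pP y) - killing c (prj kP x) (prj kP y).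

Definition Qres (P : pred 'I_N) (x y : 'rV[R]_N) : R := Qform (prj P x) (prj P y).

(* points of M_K: parameters (beta, alpha_1, alpha_2) *)
Definition metricK (q : R * R * R) : 'M[R]_N :=
  gram (fun x y => q.1.1 * Qres pP x y + q.1.2 * Qres k1P x y + q.2 * Qres k2P x y).

Definition is_MK (q : R * R * R) : Prop := 0 < q.1.1 /\ 0 < q.1.2 /\ 0 < q.2.

Variables Tp T1 T2 : R.

Definition Ttensor : 'M[R]_N :=
  gram (fun x y => - Tp * Qres pP x y + T1 * Qres k1P x y + T2 * Qres k2P x y).

Definition trT (q : R * R * R) : R := trform (metricK q) Ttensor.

Definition Sfun (q : R * R * R) : R := scal c (metricK q).

Definition in_MT0 (q : R * R * R) : Prop := is_MK q /\ trT q = 0.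

Definition shift (q : R * R * R) (t : R) (v : R * R * R) : R * R * R :=
  (q.1.1 + t * v.1.1, q.1.2 + t * v.1.2, q.2 + t * v.2).

Definition has_dirderiv (f : R * R * R -> R) (q v : R * R * R) (l : R) : Prop :=
  derivable (fun t : R => f (shift q t v)) 0 1 /\
  derive1 (fun t : R => f (shift q t v)) 0 = l.

Definition tangent_MT0 (q v : R * R * R) : Prop := has_dirderiv trT q v 0.

Definition critical_MT0 (q : R * R * R) : Prop :=
  in_MT0 q /\ forall v, tangent_MT0 q v -> has_dirderiv Sfun q v 0.

Definition near_q (e : R) (q q' : R * R * R) : Prop :=
  `|q'.1.1 - q.1.1| < e /\ `|q'.1.2 - q.1.2| < e /\ `|q'.2 - q.2| < e.

Definition local_max_MT0 (q : R * R * R) : Prop :=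
  in_MT0 q /\ exists e, 0 < e /\
    forall q', in_MT0 q' -> near_q e q q' -> Sfun q' <= Sfun q.

Definition local_min_MT0 (q : R * R * R) : Prop :=
  in_MT0 q /\ exists e, 0 < e /\
    forall q', in_MT0 q' -> near_q e q q' -> Sfun q <= Sfun q'.

Definition global_max_MT0 (q : R * R * R) : Prop :=
  in_MT0 q /\ forall q', in_MT0 q' -> Sfun q' <= Sfun q.

Definition global_min_MT0 (q : R * R * R) : Prop :=
  in_MT0 q /\ forall q', in_MT0 q' -> Sfun q <= Sfun q'.

Definition saddle_MT0 (q : R * R * R) : Prop :=
  critical_MT0 q /\ ~ local_max_MT0 q /\ ~ local_min_MT0 q.

End Setting.

(* Main.v *)
Require Import Defs.
From HB Require Import structures.
From mathcomp Require Import all_boot all_order all_algebra.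
From mathcomp Require Import all_classical all_reals all_analysis.
From mathcomp Require Import ring lra.

(** Left-invariant metrics of [M_K] have the form [M *m B], with [B] the Killing
    form and [M] diagonal, scalar on each of [p], [k_1], [k_2].  For such a
    metric the covariant derivative of a left-invariant field [Y] is
    [X |-> X *m N_Y] with
    [2 N_Y = M ad_Y M^-1 - ad_Y - ad_(Y M) M^-1] (matrices act on rows), and
    [Ric (Y, Z) = - tr (N_Y N_Z)].  The scalar curvature thus reduces to the
    traces of [ad_x ad_y] between blocks, which are given by [d_i], [kappa_i]
    and the Casimir operator.  On [M_T^0], with [x = alpha_2 / beta],
    [4 beta x (n T_p x - d_2 T_2) S = - (a x^3 + b x^2 + c x + d)] and
    [x > d_2 T_2 / (n T_p)].  As [S] is homogeneous of degree -1, it vanishes at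
    a critical point, so that critical points are the multiple roots [x] of this
    cubic, and their nature depends on the position of the third root. *)

Set Implicit Arguments. Unset Strict Implicit. Unset Printing Implicit Defensive.
Import Order.TTheory GRing.Theory Num.Theory.
Import numFieldNormedType.Exports.
Local Open Scope ring_scope.

(** * Adjoint matrices and the Killing form *)

(** The adapted basis is arbitrary inside each block, so [B] is only block diagonal. Squares of
    structure constants in an orthonormal basis are therefore replaced by the contractions [tau]
    with [invmx B], and the arguments rest on the commutation of block-scalar matrices with [B] and
    its inverse. The constraint tr_g T = 0 reads n T_p / beta = d_1 T_1 / alpha_1 + d_2 T_2 /
    alpha_2. It determines alpha_1, and alpha_1 > 0 is exactly the lower bound on x; so (beta, x)
    are global coordinates on M_T^0, and beta only scales. Near a double root x with third root s,
    the sign of S is opposite to that of a (y - x)^2 (y - s): a local maximum if s < x, a local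
    minimum if s > x, a saddle if s = x. A global maximum needs the cubic to be nonnegative on the
    whole ray, so s must not exceed its end point. All this uses a > 0, that is kappa_2 < 1, which
    comes from the simplicity of g: otherwise k_2 would act trivially on p and be an ideal. *)

Section AdjointMatrices.
Variables (R : realType) (N : nat) (c : 'I_N -> 'I_N -> 'rV[R]_N).
Implicit Types x y z : 'rV[R]_N.

Lemma ev_mul (A : 'M[R]_N) i j : (ev R i *m A) 0 j = A i j.
Proof. by rewrite /ev -rowE mxE. Qed.

Lemma ev_mul_ev (A : 'M[R]_N) i j : (ev R i *m A *m (ev R j)^T) 0 0 = A i j.
Proof.
rewrite mxE (bigD1 j) //= big1 ?addr0 => [|k kj].
  by rewrite ev_mul !mxE !eqxx mulr1.
by rewrite !mxE (negPf kj) andbF mulr0.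
Qed.

Lemma gf_ev (G : 'M[R]_N) x l : gf G x (ev R l) = (x *m G) 0 l.
Proof. by rewrite /gf /ev trmx_delta -colE mxE. Qed.

Lemma gf_inj (A B : 'M[R]_N) : (forall x y, gf A x y = gf B x y) -> A = B.
Proof.
by move=> AB; apply/matrixP => i j; rewrite -[LHS]ev_mul_ev -[RHS]ev_mul_ev; exact: AB.
Qed.

Lemma lbr_is_linear x : linear (lbr c x).
Proof.
move=> a y z; rewrite /lbr scaler_sumr -big_split; apply: eq_bigr => i _ /=.
rewrite scaler_sumr -big_split; apply: eq_bigr => j _ /=.
by rewrite !mxE scalerA -scalerDl mulrDr mulrCA.
Qed.

HB.instance Definition _ x :=
  GRing.isLinear.Build R 'rV[R]_N 'rV[R]_N *:%R (lbr c x) (lbr_is_linear x).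

Lemma mul_adm x y : y *m adm c x = lbr c x y.
Proof.
rewrite {2}(row_sum_delta y) linear_sum; apply/rowP => j.
by rewrite mxE summxE; apply: eq_bigr => i _; rewrite linearZ /= !mxE.
Qed.

Lemma adm_is_linear : linear (adm c).
Proof.
move=> a x y; apply/matrixP => i j; rewrite !mxE /lbr !summxE mulr_sumr -big_split.
apply: eq_bigr => k _ /=; rewrite !summxE mulr_sumr -big_split.
by apply: eq_bigr => l _ /=; rewrite !mxE; ring.
Qed.

HB.instance Definition _ :=
  GRing.isLinear.Build R 'rV[R]_N 'M[R]_N *:%R (adm c) adm_is_linear.

Lemma adm_ev (i j k : 'I_N) : adm c (ev R i) j k = lbr c (ev R i) (ev R j) 0 k.
Proof. by rewrite mxE. Qed.

Lemma killingE x y : killing c x y = gf (gram (killing c)) x y.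
Proof.
rewrite /gf mxE.
have admE z : adm c z = \sum_i z 0 i *: adm c (ev R i).
  by rewrite {1}(row_sum_delta z) linear_sum; apply: eq_bigr => i _; rewrite linearZ.
rewrite /killing admE (admE y) mulmx_sumr raddf_sum; apply: eq_bigr => j _ /=.
rewrite mulmx_suml raddf_sum /= !mxE mulr_suml; apply: eq_bigr => i _.
by rewrite -scalemxAl -scalemxAr !linearZ /= !mxE /killing; ring.
Qed.

Lemma killingC x y : killing c x y = killing c y x.
Proof. exact: mxtrace_mulC. Qed.

Lemma gram_killing_sym : (gram (killing c))^T = gram (killing c).
Proof. by apply/matrixP => i j; rewrite !mxE killingC. Qed.

Hypothesis Lc : is_lie_algebra c.

Lemma lbrC x y : lbr c x y = - lbr c y x.
Proof. by case: Lc. Qed.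

Lemma mul_admC x y : y *m adm c x = - (x *m adm c y).
Proof. by rewrite !mul_adm lbrC. Qed.

(** The Jacobi identity; the products come in reverse order because matrices act on rows from the
    right. *)
Lemma adm_lbr x y :
  adm c (lbr c x y) = adm c y *m adm c x - adm c x *m adm c y.
Proof.
apply/row_matrixP => i; rewrite !rowE mulmxBr !mulmxA !mul_adm.
case: Lc => [C J]; have := J x y (delta_mx 0 i).
rewrite [lbr c (delta_mx 0 i) (lbr c x y)]C => /subr0_eq <-.
by rewrite [lbr c (delta_mx 0 i) x]C linearN /=.
Qed.

Lemma killing_invariant x y z : killing c (lbr c x y) z = killing c x (lbr c y z).
Proof.
rewrite /killing !adm_lbr mulmxBl mulmxBr !linearB /=; congr (_ - _).
  by rewrite -mulmxA mxtrace_mulC -mulmxA.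
by rewrite mulmxA.
Qed.

Lemma adm_skew x :
  adm c x *m gram (killing c) = - (gram (killing c) *m (adm c x)^T).
Proof.
apply: gf_inj => y z; rewrite /gf mulmxN mulNmx [RHS]mxE !mulmxA mul_adm.
rewrite -[in RHS](mulmxA _ _^T) -trmx_mul mul_adm.
rewrite -!/(gf _ _ _) -!killingE lbrC -scaleN1r -killing_invariant /killing.
by rewrite linearZ /= -scalemxAl linearZ /= mulN1r.
Qed.

End AdjointMatrices.

(** * Curvature of metrics [M *m B] with [M] diagonal and [B] the Killing form *)

Section DiagonalMetric.
Variables (R : realType) (N : nat) (c : 'I_N -> 'I_N -> 'rV[R]_N).
Hypothesis Lc : is_lie_algebra c.
Local Notation A := (adm c).
Local Notation B := (gram (killing c)).
Local Notation J := (invmx B).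
Hypothesis Bunit : B \in unitmx.
Variable mu : 'I_N -> R.
Hypothesis mu_neq0 : forall i, mu i != 0.
Local Notation M := (diag_mx (\row_i mu i)).
Local Notation m := (diag_mx (\row_i (mu i)^-1)).
Hypothesis MB : M *m B = B *m M.
Implicit Types X Y Z W : 'rV[R]_N.

Lemma diag_mulV : M *m m = 1%:M.
Proof.
rewrite mulmx_diag -diag_const_mx; congr diag_mx.
by apply/rowP => i; rewrite !mxE mulfV.
Qed.

Lemma diag_mulVl : m *m M = 1%:M.
Proof. exact: mulmx1C diag_mulV. Qed.

Lemma diag_inv_comm : m *m B = B *m m.
Proof.
rewrite -[LHS]mulmx1 -diag_mulV mulmxA -(mulmxA m) -MB (mulmxA m).
by rewrite diag_mulVl mul1mx.
Qed.

Lemma comm_mx_invmx (C D : 'M[R]_N) : D \in unitmx ->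
  C *m D = D *m C -> C *m invmx D = invmx D *m C.
Proof.
move=> Du CD; rewrite -[LHS]mul1mx -(mulVmx Du) -mulmxA (mulmxA D) -CD.
by rewrite -(mulmxA C) (mulmxV Du) mulmx1.
Qed.

Lemma diag_inv_commJ : m *m J = J *m m.
Proof. exact: comm_mx_invmx diag_inv_comm. Qed.

Lemma invmx_unique (C D : 'M[R]_N) : C *m D = 1%:M -> invmx C = D.
Proof.
move=> CD; have [Cu _] := mulmx1_unit CD.
by rewrite -[LHS]mulmx1 -CD mulmxA mulVmx // mul1mx.
Qed.

Lemma invmx_metric : invmx (M *m B) = J *m m.
Proof.
apply: invmx_unique; rewrite mulmxA -(mulmxA M) mulmxV // mulmx1.
exact: diag_mulV.
Qed.

Lemma killing_inv_sym : J^T = J.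
Proof. by rewrite trmx_inv gram_killing_sym. Qed.

(* [X *m nabmx Y] is the covariant derivative of [Y] along [X]. *)
Definition nabmx Y : 'M[R]_N :=
  2%:R^-1 *: (M *m A Y *m m - A Y - A (Y *m M) *m m).

(** With g(U, V) written as B(U M, V), invariance of [B] moves each bracket until [Z] stands alone
    in the second argument; the first is then [X *m nabmx Y *m M]. *)
Lemma koszulE X Y Z : koszul c (M *m B) X Y Z = gf (M *m B) (X *m nabmx Y) Z.
Proof.
have gM U V : gf (M *m B) U V = gf B (U *m M) V by rewrite /gf !mulmxA.
have gC U V : gf B U V = gf B V U by rewrite -!killingE killingC.
have gMr U V : gf (M *m B) U V = gf B U (V *m M).
  by rewrite /gf MB trmx_mul tr_diag_mx !mulmxA.
have gZ a U V : gf B (a *: U) V = a * gf B U V.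
  by rewrite /gf -!scalemxAl mxE.
have gN U V : gf B (- U) V = - gf B U V by rewrite -scaleN1r gZ mulN1r.
have gD U V W : gf B (U + V) W = gf B U W + gf B V W.
  by rewrite /gf !mulmxDl mxE.
have NM : X *m nabmx Y *m M =
    2%:R^-1 *: (lbr c Y (X *m M) - lbr c Y X *m M - lbr c (Y *m M) X).
  rewrite -!mul_adm /nabmx -scalemxAr -scalemxAl.
  by rewrite !(mulmxBr, mulmxBl) !mulmxA -!(mulmxA _ m M) diag_mulVl !mulmx1.
rewrite /koszul (gM (X *m _)) NM gZ !gD !gN mulrC; congr (_ * _).
rewrite gM (gMr (lbr c Y Z)) (gMr (lbr c Z X)) (lbrC Lc X Y) mulNmx gN.
have -> : gf B (lbr c Y Z) (X *m M) = - gf B (lbr c Y (X *m M)) Z.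
  by rewrite gC -!gN -(lbrC Lc) -!killingE -(killing_invariant Lc).
have -> : gf B (lbr c Z X) (Y *m M) = - gf B (lbr c (Y *m M) X) Z.
  by rewrite -gN -(lbrC Lc) -!killingE (killing_invariant Lc) killingC.
by rewrite opprK addrC addrA [in RHS]addrAC addrC addrA.
Qed.

Lemma lcnablaE X Y : lcnabla c (M *m B) X Y = X *m nabmx Y.
Proof.
have Gu : M *m B \in unitmx.
  rewrite unitmx_mul Bunit andbT; have [] // := mulmx1_unit diag_mulV.
rewrite /lcnabla -[RHS]mulmx1 -(mulmxV Gu) mulmxA.
apply/rowP => l; rewrite summxE mxE; apply: eq_bigr => k _.
rewrite summxE (bigD1 l) //= big1 ?addr0 => [|j jl]; last first.
  by rewrite !mxE eq_sym (negPf jl) andbF mulr0.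
rewrite !mxE !eqxx mulr1 koszulE; congr (_ * _).
rewrite /gf mxE (bigD1 k) //= big1 ?addr0 => [|j jk].
  by rewrite !mxE !eqxx mulr1.
by rewrite !mxE (negPf jk) andbF mulr0.
Qed.

Lemma nabmx_torsion X Y : X *m nabmx Y = Y *m nabmx X + lbr c X Y.
Proof.
rewrite /nabmx -mul_adm -!scalemxAr !mulmxBr !mulmxA.
rewrite (mul_admC Lc (Y *m M) X) (mul_admC Lc Y (X *m M)) (mul_admC Lc X Y).
rewrite !mulNmx; apply/rowP => i; rewrite !mxE; lra.
Qed.

(** In [nabmx Y] the first two terms have equal traces by conjugation. The third is a [B]-skew
    matrix times a [B]-self-adjoint one, so its trace equals its own opposite. *)
Lemma tr_nabmx Y : \tr (nabmx Y) = 0.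
Proof.
have E : \tr (A (Y *m M) *m m) = 0.
  set V := Y *m M; suff H : \tr (A V *m m) = - \tr (A V *m m) by lra.
  rewrite -{1}[A V](mulmxK Bunit) adm_skew // !mulNmx linearN /=; congr (- _).
  rewrite -!mulmxA mxtrace_mulC -diag_inv_commJ -!mulmxA mulVmx //.
  by rewrite mulmx1 -mxtrace_tr trmx_mul trmxK tr_diag_mx mxtrace_mulC.
rewrite /nabmx linearZ !linearB /= E subr0 mxtrace_mulC mulmxA diag_mulVl mul1mx.
by rewrite subrr mulr0.
Qed.

(** Torsion-freeness turns the derivative along [Y] of X |-> [X *m nabmx Z] into right
    multiplications, so the curvature is [X *m C]. In the trace of [C] the first term vanishes by
    [tr_nabmx] and the two terms with ad_Y cancel cyclically. *)
Lemma ricciE Y Z : ricci c (M *m B) Y Z = - \tr (nabmx Y *m nabmx Z).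
Proof.
pose C := nabmx (Y *m nabmx Z) - nabmx Z *m (nabmx Y + A Y) + A Y *m nabmx Z.
have CE X : curv c (M *m B) X Y Z = X *m C.
  rewrite /curv !lcnablaE (nabmx_torsion Y (X *m _)) -mul_adm (lbrC Lc X Y) -mul_adm.
  by rewrite /C mulmxDr mulmxBr mulNmx opprK !mulmxA mulmxDr.
have Gu : M *m B \in unitmx.
  by rewrite unitmx_mul Bunit andbT; have [] // := mulmx1_unit diag_mulV.
transitivity (\tr (C *m (M *m B) *m (invmx (M *m B))^T)).
  rewrite /ricci /mxtrace; apply: eq_bigr => i _; rewrite mxE; apply: eq_bigr => k _.
  by rewrite CE /gf -(mulmxA _ C) ev_mul_ev mulrC [_^T _ _]mxE.
have -> : (invmx (M *m B))^T = invmx (M *m B).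
  by rewrite invmx_metric trmx_mul tr_diag_mx killing_inv_sym diag_inv_commJ.
rewrite -(mulmxA C) mulmxV // mulmx1 /C linearD linearB /= tr_nabmx sub0r mulmxDr linearD /=.
by rewrite [\tr (A Y *m _)]mxtrace_mulC opprD addrNK mxtrace_mulC.
Qed.

Lemma nabmx_ev j i k :
  nabmx (ev R j) i k = 2%:R^-1 * ((mu i - mu j - mu k) / mu k) * A (ev R j) i k.
Proof.
rewrite /nabmx; have -> : ev R j *m M = mu j *: ev R j.
  apply/rowP => l; rewrite mul_mx_diag !mxE eqxx /=.
  by case: eqP => [->|]; rewrite ?mulr0 ?mul0r // mulr1 mul1r.
rewrite linearZ /= -scalemxAl.
move: (A (ev R j)) => a; rewrite !(mul_mx_diag, mul_diag_mx) !mxE.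
field; exact: mu_neq0.
Qed.

(** In a basis where [B] is diagonal with entries 1 and -1, this is up to sign the square of a
    structure constant; the contraction with [J] replaces the choice of such a basis. *)
Definition tau (i k l : 'I_N) : R :=
  \sum_j J j l * A (ev R j) i k * A (ev R l) k i.

(** The weight is the product of the two factors from [nabmx_ev]: (mu i - mu k - mu l) (mu k - mu i
    - mu l) = mu l ^ 2 - (mu i - mu k) ^ 2. *)
Lemma scalE : scal c (M *m B) = - 4%:R^-1 *
  \sum_i \sum_k \sum_l (mu l ^+ 2 - (mu i - mu k) ^+ 2) / (mu i * mu k * mu l)
     * tau i k l.
Proof.
(* [M] commutes with [J], so the two indices contracted by [J] carry the same eigenvalue. *)
have JM j l : J j l * mu j = J j l * mu l.
  have : M *m J = J *m M by exact: comm_mx_invmx.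
  move/matrixP/(_ j l); rewrite mul_diag_mx mul_mx_diag !mxE => <-.
  by rewrite mulrC.
rewrite /scal invmx_metric.
transitivity (\sum_j \sum_l \sum_i \sum_k - 4%:R^-1 *
  ((mu l ^+ 2 - (mu i - mu k) ^+ 2) / (mu i * mu k * mu l)
   * (J j l * A (ev R j) i k * A (ev R l) k i))).
  apply: eq_bigr => j _; apply: eq_bigr => l _.
  rewrite ricciE mul_mx_diag [X in X * _]mxE mulrN -mulNr.
  rewrite /mxtrace mulr_sumr; apply: eq_bigr => i _.
  rewrite [(_ *m _) _ _]mxE mulr_sumr; apply: eq_bigr => k _.
  rewrite !nabmx_ev [(\row__ _) _ _]mxE.
  have hj : J j l * (mu i - mu j - mu k) = J j l * (mu i - mu l - mu k).
    by rewrite !mulrBr JM.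
  transitivity (- 4%:R^-1 * (J j l * (mu i - mu j - mu k)) / mu l / mu k *
    A (ev R j) i k * ((mu k - mu l - mu i) / mu i) * A (ev R l) k i).
    by field; rewrite !mu_neq0.
  by rewrite hj; field; rewrite !mu_neq0.
rewrite mulr_sumr exchange_big /=.
transitivity (\sum_i \sum_k \sum_l \sum_j - 4%:R^-1 *
  ((mu l ^+ 2 - (mu i - mu k) ^+ 2) / (mu i * mu k * mu l)
   * (J j l * A (ev R j) i k * A (ev R l) k i))).
  under eq_bigr do (under eq_bigr do under eq_bigr do idtac; rewrite exchange_big /=).
  rewrite exchange_big /=; apply: eq_bigr => i _.
  under eq_bigr do rewrite exchange_big /=.
  by rewrite exchange_big.
apply: eq_bigr => i _; rewrite mulr_sumr; apply: eq_bigr => k _.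
rewrite mulr_sumr; apply: eq_bigr => l _.
by rewrite /tau !mulr_sumr.
Qed.

End DiagonalMetric.

(** * Positive definite matrices *)

Section PositiveDefinite.
Variable R : realType.

Definition posdef N (G : 'M[R]_N) : Prop := forall x, x != 0 -> 0 < gf G x x.

Lemma posdef_unit N (G : 'M[R]_N) : posdef G -> G \in unitmx.
Proof.
move=> Gp; rewrite unitmxE unitfE; apply/negP => /det0P[v v0 vG].
by have := Gp v v0; rewrite /gf vG mul0mx mxE ltxx.
Qed.

(** Induction on the size: the Schur complement [S] of the corner entry is again symmetric and
    positive definite. *)
Lemma cholesky N (G : 'M[R]_N) : G^T = G -> posdef G ->
  exists L : 'M[R]_N, G = L *m L^T.
Proof.
elim: N G => [|N IH] G Gs Gp; first by exists 0; apply/matrixP => -[].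
rewrite -[N.+1]/(1 + N)%N in G Gs Gp *.
pose g := G 0 0; pose r := ursubmx G; pose G' := drsubmx G.
have g0 : 0 < g.
  have := Gp (ev R 0); rewrite /gf ev_mul_ev; apply; apply/eqP => /rowP/(_ 0).
  by rewrite !mxE !eqxx => /eqP; rewrite oner_eq0.
have GE : G = block_mx g%:M r r^T G'.
  rewrite -[LHS](submxK G); congr block_mx.
    by apply/matrixP => i j; rewrite !ord1 !mxE !lshift0 mulr1n.
  by rewrite /r trmx_ursub Gs.
have G's : G'^T = G' by rewrite /G' trmx_drsub Gs.
pose S := G' - g^-1 *: (r^T *m r).
have Ss : S^T = S by rewrite /S linearB linearZ /= trmx_mul trmxK G's.
have [|L' SE] := IH S Ss.
  (* The first coordinate minimises the quadratic form of [G] for given [y]; the minimum is the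
     value of [S] at [y]. *)
  move=> y y0; have z0 : row_mx (- g^-1 *: (y *m r^T)) y != 0.
    by apply: contraNneq y0; rewrite -row_mx0 => /eq_row_mx[_ ->].
  have := Gp _ z0; rewrite {1}GE /gf mul_row_block tr_row_mx mul_row_col.
  have -> : - g^-1 *: (y *m r^T) *m g%:M + y *m r^T = 0.
    by rewrite mul_mx_scalar scalerA mulrN mulfV ?gt_eqF // scaleN1r addNr.
  rewrite mul0mx add0r -scalemxAl -mulmxA scaleNr addrC scalemxAr.
  by rewrite -mulmxBr.
pose s := Num.sqrt g.
have s0 : s != 0 by rewrite gt_eqF // sqrtr_gt0.
have ss : s * s = g by rewrite -expr2 sqr_sqrtr // ltW.
exists (block_mx s%:M 0 (s^-1 *: r^T) L').
rewrite tr_block_mx mulmx_block !trmx0 !mul0mx !mulmx0 !addr0 GE; congr block_mx.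
- by rewrite tr_scalar_mx -scalar_mxM ss.
- by rewrite linearZ /= trmxK mul_scalar_mx scalerA mulfV // scale1r.
- by rewrite tr_scalar_mx mul_mx_scalar scalerA mulfV // scale1r.
rewrite -SE linearZ /= trmxK -scalemxAl -scalemxAr scalerA -invfM ss /S.
by rewrite addrC subrK.
Qed.

Lemma tr_mul_trmx_ge0 N (C : 'M[R]_N) : 0 <= \tr (C *m C^T).
Proof.
apply: sumr_ge0 => i _; rewrite mxE; apply: sumr_ge0 => j _.
by rewrite mxE -expr2 sqr_ge0.
Qed.

Lemma tr_mul_trmx_eq0 N (C : 'M[R]_N) : \tr (C *m C^T) = 0 -> C = 0.
Proof.
have P i : 0 <= (C *m C^T) i i.
  by rewrite mxE; apply: sumr_ge0 => j _; rewrite mxE -expr2 sqr_ge0.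
move=> C0; apply/matrixP => i j; rewrite [RHS]mxE.
have /eqP := psumr_eq0P (fun i _ => P i) C0 (i := i) isT.
rewrite mxE psumr_eq0 => [/allP /(_ j (mem_index_enum _))|k _].
  by rewrite mxE -expr2 sqrf_eq0 => /eqP.
by rewrite mxE -expr2 sqr_ge0.
Qed.

Lemma skew_conj N (G A : 'M[R]_N) : G^T = G -> posdef G -> A *m G = - (G *m A^T) ->
  exists L C : 'M[R]_N, [/\ L \in unitmx, A = L *m C *m invmx L & C^T = - C].
Proof.
move=> Gs Gp AG; have [L GE] := cholesky Gs Gp.
have /andP[Lu Ltu] : (L \in unitmx) && (L^T \in unitmx).
  by rewrite -unitmx_mul -GE posdef_unit.
exists L, (invmx L *m A *m L); split => //.
  by rewrite !mulmxA mulmxV // mul1mx -mulmxA mulmxV // mulmx1.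
rewrite !trmx_mul trmx_inv; apply: (canRL opprK).
rewrite -[RHS](mulmxK Ltu) -(mulmxA _ L) -GE -(mulmxA _ A) AG mulmxN mulNmx.
by rewrite GE -!mulmxA mulKmx.
Qed.

(** Conjugation by a Cholesky factor of [G] makes the matrix skew in the usual sense; the trace of
    its square is then minus a sum of squares. *)
Lemma skew_tr_sqr_le0 N (G A : 'M[R]_N) : G^T = G -> posdef G ->
  A *m G = - (G *m A^T) -> \tr (A *m A) <= 0 /\ (\tr (A *m A) = 0 -> A = 0).
Proof.
move=> Gs Gp /(skew_conj Gs Gp) [L [C [Lu -> Cs]]].
have -> : \tr (L *m C *m invmx L *m (L *m C *m invmx L)) = - \tr (C *m C^T).
  rewrite !mulmxA mulmxKV // mxtrace_mulC -!mulmxA mulKmx //.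
  by rewrite Cs mulmxN linearN /= opprK.
split=> [|/eqP]; first by rewrite oppr_le0 tr_mul_trmx_ge0.
by rewrite oppr_eq0 => /eqP/tr_mul_trmx_eq0 ->; rewrite mulmx0 mul0mx.
Qed.

End PositiveDefinite.

(** * The decomposition [g = p + k_1 + k_2] *)

Section CartanBlocks.
Variables (R : realType) (n d1 d2 : nat).
Local Notation N := (n + d1 + d2)%N.
Variable c : 'I_N -> 'I_N -> 'rV[R]_N.
Local Notation pP := (@pP n d1 d2).
Local Notation k1P := (@k1P n d1 d2).
Local Notation k2P := (@k2P n d1 d2).
Local Notation kP := (@kP n d1 d2).
Local Notation A j := (adm c (ev R j)).
Local Notation B := (gram (killing c)).
Local Notation J := (invmx B).
Implicit Types (x y z : 'rV[R]_N) (i j k l : 'I_N).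

(* The block of a coordinate: 0 for [p], 1 for [k_1], 2 for [k_2]. *)
Definition ty i : nat := if pP i then 0 else if k1P i then 1 else 2.

Lemma ty_lt3 i : (ty i < 3)%N.
Proof. by rewrite /ty; case: ifP => // _; case: ifP. Qed.

Lemma pP_ty i : pP i = (ty i == 0)%N.
Proof. by rewrite /ty; case: (pP i) => //; case: (k1P i). Qed.

Lemma k1P_ty i : k1P i = (ty i == 1)%N.
Proof.
rewrite /ty /Defs.pP /Defs.k1P; case: (ltnP i n) => //= _.
by case: (ltnP i (n + d1)).
Qed.

Lemma k2P_ty i : k2P i = (ty i == 2)%N.
Proof.
rewrite /ty /Defs.pP /Defs.k1P /Defs.k2P; case: (ltnP i n) => /= ni.
  by rewrite leqNgt (leq_trans ni) // leq_addr.
by rewrite leqNgt; case: (ltnP i (n + d1)).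
Qed.

Lemma kP_ty i : kP i = (ty i != 0)%N.
Proof. by rewrite -pP_ty /Defs.kP /Defs.pP leqNgt. Qed.

Lemma inSub_ev (P : pred 'I_N) i : P i -> inSub P (ev R i).
Proof.
by move=> Pi j Pj; rewrite !mxE eqxx /=; case: eqP => // ji; rewrite ji Pi in Pj.
Qed.

Lemma inSub_k1k x : inSub k1P x -> inSub kP x.
Proof. by move=> xk j; rewrite kP_ty negbK => /eqP j0; apply: xk; rewrite k1P_ty j0. Qed.

Lemma inSub_k2k x : inSub k2P x -> inSub kP x.
Proof. by move=> xk j; rewrite kP_ty negbK => /eqP j0; apply: xk; rewrite k2P_ty j0. Qed.

Lemma inSub_k12 x : inSub k1P x -> inSub k2P x -> x = 0.
Proof.
move=> x1 x2; apply/rowP => i; rewrite mxE.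
have [/eqP i1|/x1//] := boolP (k1P i).
by apply: x2; move/eqP: i1; rewrite k1P_ty k2P_ty => /eqP ->.
Qed.

(** Simplicity quantifies over [{vspace _}]; the ideals to be tested are all obtained as kernels of
    right multiplications. *)
Lemma sub_row_mulP m p (W : 'M[R]_(m, p)) :
  exists U : {vspace 'rV[R]_m}, forall x : 'rV[R]_m, (x \in U) = (x *m W == 0).
Proof.
exists (lker (linfun (mulmxr W))) => x.
by rewrite memv_ker lfunE.
Qed.

Lemma mul_diag_eq0 x (P : pred 'I_N) :
  (x *m diag_mx (\row_j (~~ P j)%:R) == 0) <-> inSub P x.
Proof.
split=> [/eqP/rowP x0 j Pj|x0].
  by have := x0 j; rewrite mul_mx_diag !mxE Pj mulr1.
apply/eqP/rowP => j; rewrite mul_mx_diag !mxE.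
by case: (boolP (P j)) => [_|/x0 ->]; rewrite ?mulr0 ?mul0r.
Qed.

Hypothesis Lc : is_lie_algebra c.
Hypothesis Sc : simple_lie c.
Hypothesis NCc : ~ (forall x, x != 0 -> killing c x x < 0).
Hypothesis Cc : cartan_decomposition c.
Hypothesis Kc : k_decomposition_rs2 c.

Lemma k1_simple : simple_sub c k1P.
Proof. by case: Kc => [_ [_ [[]|[]]]]. Qed.

(** If p were zero, g would be k and its Killing form negative definite, contrary to
    non-compactness. *)
Lemma n_gt0 : (0 < n)%N.
Proof.
rewrite lt0n; apply/negP => /eqP n0; apply: NCc => x x0.
case: Cc => [_ [_ [_ [_ [Bk _]]]]]; apply: Bk => // j.
have nj : (n <= j)%N by apply: (@leq_trans 0%N) => //; rewrite leqn0; apply/eqP.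
by rewrite /Defs.kP nj.
Qed.

Lemma simple_sub_ev (P : pred 'I_N) : simple_sub c P -> exists i, P i.
Proof.
move=> [[x [y [xP [yP xy]]]] _]; case: (pickP P) => [i Pi|nP]; first by exists i.
have x0 : x = 0 by apply/rowP => i; rewrite mxE xP ?nP.
by rewrite x0 lbrC // linear0 oppr0 eqxx in xy.
Qed.

Lemma d1_gt0 : (0 < d1)%N.
Proof.
have [i] := simple_sub_ev k1_simple; rewrite /Defs.k1P => /andP[ni].
move=> id; rewrite lt0n; apply/negP => /eqP d10; move: (leq_ltn_trans ni id).
by rewrite -[X in (X < _)%N]addn0 ltn_add2l {1}d10.
Qed.

Lemma d2_gt0 : (0 < d2)%N.
Proof.
case: Kc => [_ [_ [[_ /simple_sub_ev[i]]|[_ []//]]]].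
rewrite /Defs.k2P => ni; move: (leq_ltn_trans ni (ltn_ord i)).
by rewrite -[X in (X < _)%N]addn0 ltn_add2l.
Qed.

Lemma lbr_k12 x y : inSub k1P x -> inSub k2P y -> lbr c x y = 0.
Proof.
case: Kc => [I1 [I2 _]] x1 y2; apply: inSub_k12; last exact: I2 (inSub_k1k x1).
rewrite lbrC // => j jk; rewrite mxE I1 ?oppr0 //; exact: inSub_k2k.
Qed.

(* The vectors of [k_1] that are [B]-orthogonal to [k_2] form an ideal of the
   simple algebra [k_1] that contains all its brackets. *)
Lemma killing_k12 x y : inSub k1P x -> inSub k2P y -> killing c x y = 0.
Proof.
have [[u [v [u1 [v1 uv]]]] k1s] := k1_simple.
have [U1 U1E] := sub_row_mulP (diag_mx (\row_j (~~ k1P j)%:R)).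
have [U2 U2E] := sub_row_mulP (B *m diag_mx (\row_j (~~ ~~ k2P j)%:R)).
pose U := (U1 :&: U2)%VS.
have inU z : z \in U <-> inSub k1P z /\ forall l, k2P l -> killing c z (ev R l) = 0.
  rewrite memv_cap U1E U2E mulmxA; split=> [/andP[/mul_diag_eq0 z1 /mul_diag_eq0 z2]|].
    by split=> // l l2; rewrite killingE gf_ev z2 // l2.
  case=> z1 z2; apply/andP; split; apply/mul_diag_eq0 => // l.
  by move=> /negPn/z2; rewrite killingE gf_ev.
have brU z w : inSub k1P z -> inSub k1P w -> lbr c z w \in U.
  move=> z1 w1; apply/inU; split.
    by case: Kc => [I1 _]; exact: I1 w1 (inSub_k1k z1).
  move=> l l2; rewrite killing_invariant // lbr_k12 //; last exact: inSub_ev.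
  by rewrite killingC // /killing linear0 mul0mx linear0.
have [|z w zU w1||UE] := k1s U.
- by move=> z /inU[].
- by apply: brU => //; case/inU: zU.
- by move=> U0; move: uv; have := brU _ _ u1 v1; rewrite U0 memv0 => ->.
move=> x1 y2; have /inU[_ xz] := UE x x1.
rewrite killingC (row_sum_delta y) /killing linear_sum mulmx_suml raddf_sum big1 // => l _.
rewrite linearZ /= -scalemxAl linearZ /= -/(killing c _ _) killingC.
have [l2|l2] := boolP (k2P l); first by rewrite [killing _ _ _]xz ?mulr0.
by rewrite y2 // mul0r.
Qed.

Lemma killing_kp x y : inSub kP x -> inSub pP y -> killing c x y = 0.
Proof. by case: Cc => [_ [_ [_ [+ _]]]]; apply. Qed.

(** The inclusions [p, p] in k, [k, p] in p, [k_i, k_i] in k_i and [k_1, k_2] = 0: whether a bracket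
    of blocks [a] and [b] may have a component in block [e]. *)
Definition allowed (a b e : nat) :=
  if a == 0%N then if b == 0%N then e != 0%N else e == 0%N
  else if b == 0%N then e == 0%N else (a == b) && (b == e).

Lemma ty_cases i : [\/ ty i = 0%N /\ inSub pP (ev R i), ty i = 1%N /\ inSub k1P (ev R i)
  | ty i = 2 /\ inSub k2P (ev R i)].
Proof.
have := ty_lt3 i; case E: (ty i) => [|[|[|]]] // _.
- by constructor 1; split => //; apply: inSub_ev; rewrite pP_ty E.
- by constructor 2; split => //; apply: inSub_ev; rewrite k1P_ty E.
- by constructor 3; split => //; apply: inSub_ev; rewrite k2P_ty E.
Qed.

Lemma adm_block j i k : ~~ allowed (ty j) (ty i) (ty k) -> A j i k = 0.
Proof.
rewrite adm_ev; case: (Cc) => [kk [kp [pp _]]]; case: (Kc) => [I1 [I2 _]].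
have kp' x y : inSub pP x -> inSub kP y -> inSub pP (lbr c x y).
  by move=> xp yk l lp; rewrite lbrC // mxE kp ?oppr0.
case: (ty_cases j) => -[-> j_]; case: (ty_cases i) => -[-> i_]; rewrite /allowed /= => h.
- by apply: pp => //; rewrite kP_ty.
- by apply: kp' => //; [exact: inSub_k1k|rewrite pP_ty].
- by apply: kp' => //; [exact: inSub_k2k|rewrite pP_ty].
- by apply: kp => //; [exact: inSub_k1k|rewrite pP_ty].
- by apply: I1 => //; [exact: inSub_k1k|rewrite k1P_ty eq_sym].
- by rewrite lbr_k12 // mxE.
- by apply: kp => //; [exact: inSub_k2k|rewrite pP_ty].
- by rewrite lbrC // lbr_k12 // oppr0 mxE.
- by apply: I2 => //; [exact: inSub_k2k|rewrite k2P_ty eq_sym].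
Qed.

Lemma killing_block i j : ty i != ty j -> B i j = 0.
Proof.
rewrite mxE; case: (ty_cases i) => -[-> i_]; case: (ty_cases j) => -[-> j_] //= _;
  (try by apply: killing_k12); (try by rewrite killingC killing_k12);
  (try by apply: killing_kp => //; (exact: inSub_k1k || exact: inSub_k2k));
  by rewrite killingC killing_kp //; (exact: inSub_k1k || exact: inSub_k2k).
Qed.

Lemma diag_ty_comm (f : nat -> R) (D := diag_mx (\row_i f (ty i))) : D *m B = B *m D.
Proof.
apply/matrixP => i j; rewrite mul_diag_mx mul_mx_diag !mxE.
have [->|/killing_block] := eqVneq (ty i) (ty j); first by rewrite mulrC.
by rewrite mxE => ->; rewrite mulr0 mul0r.
Qed.

(** Minus the Cartan involution; [theta *m B] is the Gram matrix of Q. *)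
Definition theta := diag_mx (\row_i (-1) ^+ (ty i != 0)%N) : 'M[R]_N.

Lemma prj_decomp x : x = prj pP x + prj kP x.
Proof.
apply/rowP => i; rewrite !mxE kP_ty pP_ty.
by case: eqP => _ /=; rewrite ?addr0 ?add0r.
Qed.

Lemma prj_inSub (P : pred 'I_N) x : inSub P (prj P x).
Proof. by move=> i /negPf Pi; rewrite mxE Pi. Qed.

Lemma theta_posdef : posdef (theta *m B).
Proof.
move=> x x0; case: (Cc) => [_ [_ [_ [kp [k_neg p_pos]]]]].
have -> : gf (theta *m B) x x = killing c (prj pP x) (prj pP x) - killing c (prj kP x) (prj kP x).
  have xt : x *m theta = prj pP x - prj kP x.
    apply/rowP => i; rewrite mul_mx_diag !mxE kP_ty pP_ty.
    by case: eqP => _ /=; rewrite ?subr0 ?sub0r ?mulr1 ?mulrN1.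
  rewrite /gf mulmxA xt -/(gf B _ _) -killingE [X in killing c _ X = _](prj_decomp x).
  have lp : killing c (prj pP x) (prj kP x) = 0.
    by rewrite killingC kp //; exact: prj_inSub.
  have lk : killing c (prj kP x) (prj pP x) = 0 by rewrite killingC.
  move: (prj pP x) (prj kP x) lp lk => u v; rewrite /killing => lp lk.
  by rewrite linearB linearD /= mulmxDr !mulmxBl linearD !linearB /= lp lk subr0 sub0r.
have [xp0|/p_pos] := eqVneq (prj pP x) 0.
  rewrite xp0 /killing linear0 mul0mx linear0 sub0r oppr_gt0.
  apply: k_neg; first exact: prj_inSub.
  by apply: contraNneq x0 => xk0; rewrite (prj_decomp x) xp0 xk0 addr0.
have [xk0|xk0] := eqVneq (prj kP x) 0.
  by rewrite xk0 /killing linear0 mul0mx linear0 subr0; apply; exact: prj_inSub.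
move=> /(_ (prj_inSub _)) H; rewrite subr_gt0; apply: lt_trans H.
by apply: k_neg xk0; exact: prj_inSub.
Qed.

Lemma killing_unit : B \in unitmx.
Proof. by have := posdef_unit theta_posdef; rewrite unitmx_mul => /andP[]. Qed.

(** [J] commutes with the diagonal matrix of block numbers, which gives (ty i - ty j) J i j = 0. *)
Lemma killing_inv_block i j : ty i != ty j -> J i j = 0.
Proof.
have := comm_mx_invmx killing_unit (diag_ty_comm (fun a => a%:R)).
move=> /matrixP/(_ i j); rewrite mul_diag_mx mul_mx_diag !mxE => /eqP.
rewrite mulrC -subr_eq0 -mulrBr mulf_eq0 subr_eq0 eqr_nat => /orP[/eqP->//|->//].
Qed.

End CartanBlocks.

(** * Traces of products ad_x ad_y split along the blocks *)

Section BlockTraces.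
Variables (R : realType) (n d1 d2 : nat).
Local Notation N := (n + d1 + d2)%N.
Variable c : 'I_N -> 'I_N -> 'rV[R]_N.
Local Notation pP := (@pP n d1 d2).
Local Notation k1P := (@k1P n d1 d2).
Local Notation k2P := (@k2P n d1 d2).
Local Notation kP := (@kP n d1 d2).
Local Notation A j := (adm c (ev R j)).
Local Notation B := (gram (killing c)).
Local Notation J := (invmx B).
Implicit Types (x y z : 'rV[R]_N) (i j k l : 'I_N) (a b e : nat).

Lemma sum_ty (w : nat -> R) (F : 'I_N -> R) :
  \sum_i w (ty i) * F i = \sum_(a < 3) w a * \sum_(i | ty i == a) F i.
Proof.
rewrite (partition_big (fun i => Ordinal (ty_lt3 i)) xpredT) //=.
by apply: eq_bigr => a _; rewrite mulr_sumr; apply: eq_bigr => i /eqP <-.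
Qed.

Lemma sum_ty1 (F : 'I_N -> R) : \sum_i F i = \sum_(a < 3) \sum_(i | ty i == a) F i.
Proof.
transitivity (\sum_i (fun=> 1) (ty i) * F i); first by under [RHS]eq_bigr do rewrite mul1r.
by rewrite (sum_ty (fun=> 1)); apply: eq_bigr => a _; rewrite mul1r.
Qed.

Lemma card_ty (a : nat) :
  \sum_(i : 'I_N | ty i == a) (1 : R) =
  if a == 0%N then n%:R else if a == 1%N then d1%:R else if a == 2 then d2%:R else 0.
Proof.
have E (m : nat) (b : bool) : \sum_(i < m) (if b then 1 else 0 : R) = if b then m%:R else 0.
  by case: b; [rewrite big_const_ord iter_addr_0|rewrite big1].
rewrite big_mkcond big_split_ord /= big_split_ord /=.
rewrite (eq_bigr (fun=> if 0%N == a then 1 else 0)); last first.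
  by move=> i _; rewrite /ty /Defs.pP /= ltn_ord.
rewrite [X in _ + X + _](eq_bigr (fun=> if 1%N == a then 1 else 0)); last first.
  move=> i _; rewrite /ty /Defs.pP /Defs.k1P /= ltnNge leq_addr /=.
  by rewrite ltn_add2l ltn_ord.
rewrite [X in _ + X](eq_bigr (fun=> if 2%N == a then 1 else 0)); last first.
  move=> i _; rewrite /ty /Defs.pP /Defs.k1P /= -addnA ltnNge leq_addr /=.
  by rewrite addnA ltnNge leq_addr.
by rewrite !E; case: a => [|[|[|a]]] /=; rewrite ?addr0 ?add0r.
Qed.

Hypothesis Lc : is_lie_algebra c.
Hypothesis Sc : simple_lie c.
Hypothesis NCc : ~ (forall x, x != 0 -> killing c x x < 0).
Hypothesis Cc : cartan_decomposition c.
Hypothesis Kc : k_decomposition_rs2 c.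
Variables kappa1 kappa2 : R.
Hypothesis kap1 : kappa_of c k1P kappa1.
Hypothesis kap2 : kappa_of c k2P kappa2.

Let Bu : B \in unitmx. Proof. exact: killing_unit Cc. Qed.

Lemma adm_evC i j k : A j i k = - A i j k.
Proof. by rewrite !adm_ev lbrC // mxE. Qed.

(** The trilinear form B([x, y], z) is alternating: [tau c i k l] is a product of two factors, each
    of which changes sign when [k] and [l] are exchanged. *)
Lemma tauC i k l : tau c i k l = tau c i l k.
Proof.
have tE i' k' l' : tau c i' k' l' = A k' l' i' * (J *m A i') l' k'.
  rewrite /tau [X in _ = _ * X]mxE mulr_sumr; apply: eq_bigr => j _.
  have -> : J j l' = J l' j by rewrite -{1}(killing_inv_sym c) mxE.
  by rewrite (adm_evC i' j) (adm_evC k' l'); ring.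
have Js : (J *m A i)^T = - (J *m A i).
  rewrite trmx_mul (killing_inv_sym c) -[RHS]mulmx1 -(mulmxV Bu) mulmxA mulNmx.
  by rewrite -(mulmxA J) (adm_skew Lc) mulmxN mulKmx // opprK.
rewrite !tE (adm_evC k l).
by move/matrixP/(_ k l): Js; rewrite [LHS]mxE [RHS]mxE => ->; ring.
Qed.

(** The part of the trace of ad_j ad_l that runs from block [a] to block [b] and back. *)
Definition Ktr a b j l := \sum_(i | ty i == a) \sum_(k | ty k == b) A j i k * A l k i.

Definition Ttr a b e := \sum_(i | ty i == a) \sum_(k | ty k == b) \sum_(l | ty l == e)
  tau c i k l.

Lemma TtrE a b e : Ttr a b e = \sum_(l | ty l == e) \sum_j J j l * Ktr a b j l.
Proof.
rewrite /Ttr.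
under eq_bigr do rewrite exchange_big /=.
rewrite exchange_big /=; apply: eq_bigr => l _.
transitivity (\sum_(i | ty i == a) \sum_j \sum_(k | ty k == b) J j l * (A j i k * A l k i)).
  apply: eq_bigr => i _; rewrite exchange_big /=; apply: eq_bigr => k _.
  by rewrite /tau; apply: eq_bigr => j _; rewrite mulrA.
rewrite exchange_big /=; apply: eq_bigr => j _; rewrite mulr_sumr.
by apply: eq_bigr => i _; rewrite mulr_sumr.
Qed.

(** [J] is block diagonal and [J *m B] is the identity, so contracting a multiple of the Killing
    form counts the dimension of the block. *)
Lemma contract_killing (F : 'I_N -> 'I_N -> R) lam e :
  (forall j l, ty j = e -> ty l = e -> F j l = lam * B j l) ->
  \sum_(l | ty l == e) \sum_j J j l * F j l = lam * \sum_(l : 'I_N | ty l == e) 1.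
Proof.
move=> FB; rewrite mulr_sumr; apply: eq_bigr => l /eqP le.
transitivity (lam * (J *m B) l l); last by rewrite mulVmx // mxE eqxx.
rewrite mxE mulr_sumr; apply: eq_bigr => j _.
rewrite -{1}(killing_inv_sym c) [_^T _ _]mxE.
have [lj|lj] := eqVneq (ty l) (ty j); first by rewrite FB -?lj //; ring.
by rewrite (killing_inv_block Lc Cc Kc lj); ring.
Qed.

Lemma TtrC a b e : Ttr a b e = Ttr b a e.
Proof.
rewrite !TtrE.
have E a' b' : \sum_(l | ty l == e) \sum_j J j l * Ktr a' b' j l =
   \sum_(l | ty l == e) \sum_(j | ty j == e) J j l * Ktr a' b' j l.
  apply: eq_bigr => l /eqP le; rewrite [RHS]big_mkcond; apply: eq_bigr => j _.
  case: ifPn => //; rewrite -le => je.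
  by rewrite (killing_inv_block Lc Cc Kc je) mul0r.
rewrite !E exchange_big /=; apply: eq_bigr => l _; apply: eq_bigr => j _.
rewrite -[in LHS](killing_inv_sym c) [_^T _ _]mxE /Ktr exchange_big /=; congr (_ * _).
by apply: eq_bigr => i _; apply: eq_bigr => k _; rewrite mulrC.
Qed.

Lemma TtrCr a b e : Ttr a b e = Ttr a e b.
Proof.
rewrite /Ttr; apply: eq_bigr => i _; rewrite exchange_big /=.
by apply: eq_bigr => l _; apply: eq_bigr => k _; rewrite tauC.
Qed.

Lemma Ktr_forbidden a b j l : ~~ allowed (ty j) a b -> Ktr a b j l = 0.
Proof.
move=> h; rewrite /Ktr big1 // => i /eqP ia; rewrite big1 // => k /eqP kb.
by rewrite (adm_block Lc Cc Kc) ?mul0r // ia kb.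
Qed.

Lemma Ttr_forbidden a b e : ~~ allowed e a b -> Ttr a b e = 0.
Proof.
move=> h; rewrite TtrE (@contract_killing _ 0) ?mul0r // => j l je le.
by rewrite mul0r Ktr_forbidden // je.
Qed.

Lemma sum_Ktr j l : \sum_(a < 3) \sum_(b < 3) Ktr a b j l = B j l.
Proof.
rewrite mxE /killing /mxtrace sum_ty1; apply: eq_bigr => a _.
rewrite /Ktr exchange_big /=; apply: eq_bigr => i _.
by rewrite mxE sum_ty1.
Qed.

Lemma Ktr_killing_sub e (P : pred 'I_N) j l : (forall i, P i = (ty i == e)) ->
  e != 0%N -> ty j = e -> ty l = e -> Ktr e e j l = killing_sub c P (ev R l) (ev R j).
Proof.
move=> Pe e0 je le; rewrite /killing_sub (eq_bigl _ _ Pe) /Ktr.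
apply: eq_bigr => i /eqP ie; rewrite -!mul_adm -mulmxA ev_mul mxE.
rewrite [LHS]big_mkcond; apply: eq_bigr => k _; case: ifPn => // ke.
rewrite (adm_block Lc Cc Kc (j := j)) ?mul0r // je ie /allowed.
by rewrite (negPf e0) eqxx /= eq_sym.
Qed.

(** Since k_1 preserves p and k_1 and kills k_2, only two parts of the trace survive. They add up to
    [B], and the part inside k_1 is the Killing form of k_1, so the part on p is the rest. *)
Lemma Ktr_k1 j l : ty j = 1%N -> ty l = 1%N ->
  Ktr 1 1 j l = kappa1 * B j l /\ Ktr 0 0 j l = (1 - kappa1) * B j l.
Proof.
move=> j1 l1; have K1 : Ktr 1 1 j l = kappa1 * B j l.
  rewrite (Ktr_killing_sub (@k1P_ty n d1 d2)) // kap1; last 2 first.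
  - by apply: inSub_ev; rewrite k1P_ty l1.
  - by apply: inSub_ev; rewrite k1P_ty j1.
  by rewrite mxE killingC.
split=> //; move: (sum_Ktr j l); rewrite !big_ord_recl !big_ord0 /=.
have Z a b : ~~ allowed 1 a b -> Ktr a b j l = 0.
  by move=> h; apply: Ktr_forbidden; rewrite j1.
rewrite K1 (Z 0 1)%N // (Z 0 2)%N // (Z 1 0)%N // (Z 1 2)%N // (Z 2 0)%N //.
rewrite (Z 2 1)%N // (Z 2 2)%N //.
by move=> E; lra.
Qed.

Lemma Ktr_k2 j l : ty j = 2 -> ty l = 2 ->
  Ktr 2 2 j l = kappa2 * B j l /\ Ktr 0 0 j l = (1 - kappa2) * B j l.
Proof.
move=> j2 l2; have K2 : Ktr 2 2 j l = kappa2 * B j l.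
  rewrite (Ktr_killing_sub (@k2P_ty n d1 d2)) // kap2; last 2 first.
  - by apply: inSub_ev; rewrite k2P_ty l2.
  - by apply: inSub_ev; rewrite k2P_ty j2.
  by rewrite mxE killingC.
split=> //; move: (sum_Ktr j l); rewrite !big_ord_recl !big_ord0 /=.
have Z a b : ~~ allowed 2 a b -> Ktr a b j l = 0.
  by move=> h; apply: Ktr_forbidden; rewrite j2.
rewrite K2 (Z 0 1)%N // (Z 0 2)%N // (Z 1 0)%N // (Z 1 1)%N // (Z 1 2)%N //.
rewrite (Z 2 0)%N // (Z 2 1)%N //.
by move=> E; lra.
Qed.

Lemma Ttr_111 : Ttr 1 1 1 = kappa1 * d1%:R.
Proof. by rewrite TtrE (@contract_killing _ kappa1) ?card_ty // => j l j1 /(Ktr_k1 j1)[]. Qed.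

Lemma Ttr_222 : Ttr 2 2 2 = kappa2 * d2%:R.
Proof. by rewrite TtrE (@contract_killing _ kappa2) ?card_ty // => j l j1 /(Ktr_k2 j1)[]. Qed.

Lemma Ttr_001 : Ttr 0 0 1 = (1 - kappa1) * d1%:R.
Proof. by rewrite TtrE (@contract_killing _ (1 - kappa1)) ?card_ty // => j l j1 /(Ktr_k1 j1)[]. Qed.

Lemma Ttr_002 : Ttr 0 0 2 = (1 - kappa2) * d2%:R.
Proof. by rewrite TtrE (@contract_killing _ (1 - kappa2)) ?card_ty // => j l j1 /(Ktr_k2 j1)[]. Qed.

(* The Casimir operator of the adjoint representation is the identity; here
   its trace on [p] is computed. *)
Lemma casimir_p : 2%:R * ((1 - kappa1) * d1%:R + (1 - kappa2) * d2%:R) = n%:R :> R.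
Proof.
have : \sum_(a < 3) \sum_(b < 3) Ttr a b 0 = n%:R.
  have := @contract_killing (fun j l => B j l) 1 0 (fun j l _ _ => esym (mul1r _)).
  rewrite card_ty mul1r => <-.
  transitivity (\sum_(a < 3) \sum_(l | ty l == 0%N) \sum_j \sum_(b < 3) J j l * Ktr a b j l).
    apply: eq_bigr => a _; under eq_bigr do rewrite TtrE.
    rewrite exchange_big /=; apply: eq_bigr => l _.
    by rewrite exchange_big.
  rewrite exchange_big /=; apply: eq_bigr => l _; rewrite exchange_big /=.
  apply: eq_bigr => j _; rewrite -sum_Ktr mulr_sumr; apply: eq_bigr => a _.
  by rewrite mulr_sumr.
have Z a b := @Ttr_forbidden a b 0; rewrite !big_ord_recl !big_ord0 /=.
rewrite (Z 0 0)%N // (Z 1 1)%N // (Z 1 2)%N // (Z 2 1)%N // (Z 2 2)%N //.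
rewrite (TtrC 1) (TtrC 2) (TtrCr 0 1 0) (TtrCr 0 2 0) Ttr_001 Ttr_002 => <-; ring.
Qed.

End BlockTraces.

(** * The bound on kappa_2, and trace and scalar curvature in the parameters *)

Section CurvatureFormula.
Variables (R : realType) (n d1 d2 : nat).
Local Notation N := (n + d1 + d2)%N.
Variable c : 'I_N -> 'I_N -> 'rV[R]_N.
Local Notation pP := (@pP n d1 d2).
Local Notation k1P := (@k1P n d1 d2).
Local Notation k2P := (@k2P n d1 d2).
Local Notation kP := (@kP n d1 d2).
Local Notation A j := (adm c (ev R j)).
Local Notation B := (gram (killing c)).
Local Notation J := (invmx B).
Implicit Types (x y z : 'rV[R]_N) (i j k l : 'I_N) (a b e : nat).
Hypothesis Lc : is_lie_algebra c.
Hypothesis Sc : simple_lie c.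
Hypothesis NCc : ~ (forall x, x != 0 -> killing c x x < 0).
Hypothesis Cc : cartan_decomposition c.
Hypothesis Kc : k_decomposition_rs2 c.
Variables kappa1 kappa2 : R.
Hypothesis kap1 : kappa_of c k1P kappa1.
Hypothesis kap2 : kappa_of c k2P kappa2.

Let Bu : B \in unitmx. Proof. exact: killing_unit Cc. Qed.

Lemma exists_k2 : exists l, ty (n := n) (d1 := d1) (d2 := d2) l = 2.
Proof.
have lt : (n + d1 < N)%N by rewrite -[X in (X < _)%N]addn0 ltn_add2l (d2_gt0 Lc Kc).
by exists (Ordinal lt); apply/eqP; rewrite -k2P_ty /Defs.k2P /=.
Qed.

Lemma exists_p : exists i, ty (n := n) (d1 := d1) (d2 := d2) i = 0%N.
Proof.
have lt : (0 < N)%N by rewrite -addnA addn_gt0 (n_gt0 NCc Cc).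
by exists (Ordinal lt); apply/eqP; rewrite -pP_ty /Defs.pP /= (n_gt0 NCc Cc).
Qed.

(* [k_2] would otherwise be an ideal of [g]. *)
Lemma k2_acts_on_p : exists l i k, [/\ ty l = 2, ty i = 0%N & A l i k != 0].
Proof.
apply: contrapT => H.
have A0 l i k : ty l = 2 -> ty i = 0%N -> A l i k = 0.
  move=> l2 i0; apply/eqP/negPn/negP => Aik; apply: H.
  by exists l, i, k.
have [U UE] := sub_row_mulP (diag_mx (\row_j (~~ k2P j)%:R)) : exists U : {vspace 'rV[R]_N}, _.
have inU x : x \in U <-> inSub k2P x by rewrite UE; exact: mul_diag_eq0.
have [i0 i0p] := exists_p; have [l0 l02] := exists_k2.
case: Sc => _ /(_ U) []; last first.
- move=> UF; have /inU/(_ i0) : ev R i0 \in U by rewrite UF memvf.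
  rewrite k2P_ty i0p => /(_ isT); rewrite !mxE !eqxx /= => /eqP.
  by rewrite oner_eq0.
- move=> U0; have /inU : inSub k2P (ev R l0) by apply: inSub_ev; rewrite k2P_ty l02.
  rewrite U0 memv0 => /eqP/rowP/(_ l0); rewrite !mxE !eqxx /= => /eqP.
  by rewrite oner_eq0.
move=> x y /inU xk2; apply/inU => k; rewrite k2P_ty => k2.
rewrite -mul_adm (row_sum_delta y) linear_sum mulmx_sumr summxE big1 // => i _.
rewrite linearZ /= -scalemxAr mxE [X in _ * X]mxE big1 ?mulr0 // => l _.
have [l2|l2] := boolP (k2P l); last by rewrite xk2 // mul0r.
move: l2; rewrite k2P_ty => /eqP l2; suff -> : A i l k = 0 by rewrite mulr0.
have [i0'|i0'] := eqVneq (ty i) 0%N; first by rewrite adm_evC // A0 // oppr0.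
apply: (adm_block Lc Cc Kc); rewrite l2 /allowed (negPf i0') /=.
by rewrite negb_and [(2 == _)%N]eq_sym k2 orbT.
Qed.

(** For l in k_2, the matrix [A l *m D] is ad_l restricted to p. It is skew for the positive
    definite form Q, so [skew_tr_sqr_le0] applies to it. *)
Lemma Ktr_00_le0 l : ty l = 2 -> Ktr c 0 0 l l <= 0 /\
  (Ktr c 0 0 l l = 0 -> forall i k, ty i = 0%N -> A l i k = 0).
Proof.
move=> l2; pose D : 'M[R]_N := diag_mx (\row_i (ty i == 0%N)%:R).
(* An element of k preserves both p and k, so its adjoint matrix commutes with any matrix that is
   scalar on each; used for [D] and for [theta]. *)
have AD (f : nat -> R) (F := diag_mx (\row_i f (ty i != 0%N))) : A l *m F = F *m A l.
  apply/matrixP => i k; rewrite mul_diag_mx mul_mx_diag !mxE -/(adm c _).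
  have [E|E] := eqVneq (ty i == 0%N) (ty k == 0%N); first by rewrite E mulrC.
  have h : ~~ allowed (ty l) (ty i) (ty k).
    by move: E; rewrite l2 /allowed; case: (ty i) => [|?]; case: (ty k) => [|?];
      rewrite ?andbF.
  by have := adm_block Lc Cc Kc h; rewrite mxE => ->; rewrite mul0r mulr0.
have DE : D = diag_mx (\row_i (fun a => (a == 0)%N%:R) (ty i != 0%N : nat)).
  by congr diag_mx; apply/rowP => i; rewrite !mxE; case: eqP.
have tE : theta R n d1 d2 = diag_mx (\row_i (fun a => (-1) ^+ a) (ty i != 0%N : nat)) by [].
have AD0 := AD (fun a => (a == 0)%N%:R); rewrite -DE in AD0.
have ADt := AD (fun a => (-1) ^+ a); rewrite -tE in ADt.
have thB : theta R n d1 d2 *m B = B *m theta R n d1 d2.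
  exact: (diag_ty_comm Lc Cc Kc (fun a => (-1) ^+ (a != 0%N))).
have DB : D *m B = B *m D by exact: (diag_ty_comm Lc Cc Kc (fun a => (a == 0)%N%:R)).
have Dth : D *m theta R n d1 d2 = theta R n d1 d2 *m D.
  by rewrite /D /theta !mulmx_diag; congr diag_mx; apply/rowP => i; rewrite !mxE mulrC.
have DD : D *m D = D.
  rewrite /D mulmx_diag; congr diag_mx; apply/rowP => i; rewrite !mxE.
  by case: eqP; rewrite ?mul1r ?mul0r.
have [] := @skew_tr_sqr_le0 _ _ (theta R n d1 d2 *m B) (A l *m D).
- by rewrite trmx_mul gram_killing_sym tr_diag_mx thB.
- exact: theta_posdef.
- rewrite -mulmxA (mulmxA D) Dth -(mulmxA _ D) DB (mulmxA (A l)) ADt.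
  rewrite -mulmxA (mulmxA (A l)) (adm_skew Lc) trmx_mul tr_diag_mx.
  rewrite mulNmx mulmxN; congr (- _); rewrite -!mulmxA; congr (_ *m (_ *m _)).
  by have := congr1 trmx AD0; rewrite !trmx_mul tr_diag_mx => ->.
have -> : \tr (A l *m D *m (A l *m D)) = Ktr c 0 0 l l.
  rewrite /Ktr [RHS]big_mkcond; apply: eq_bigr => i _.
  rewrite mxE; under eq_bigr do rewrite !mul_mx_diag !mxE -/(adm c _).
  case: ifPn => i0; last by rewrite big1 // => k _; rewrite !mulr0.
  rewrite [RHS]big_mkcond; apply: eq_bigr => k _; rewrite mulr1 !adm_ev.
  by case: ifP => _; rewrite ?mulr1 // mulr0 mul0r.
move=> le0 eq0; split=> // /eq0 ADl i k i0.
have [k0|k0] := eqVneq (ty k) 0%N.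
  move/matrixP/(_ i k): ADl.
  by rewrite mul_mx_diag [LHS]mxE [X in _ * X]mxE k0 mulr1 => ->; rewrite mxE.
by apply: (adm_block Lc Cc Kc); rewrite l2 i0 /allowed.
Qed.

(** The trace of (ad_l)^2 on p is (1 - kappa_2) B(l, l) and is nonpositive, while B(l, l) < 0.
    Equality kappa_2 = 1 would make k_2 act trivially on p. This gives the positive leading
    coefficient of the cubic. *)
Lemma kappa2_lt1 : kappa2 < 1.
Proof.
have [l [i [k [l2 i0 Alik]]]] := k2_acts_on_p.
have [le0 eq0] := Ktr_00_le0 l2.
have [_ KE] := Ktr_k2 Lc Cc Kc kap2 l2 l2.
have Bneg : B l l < 0.
  rewrite mxE; case: Cc => [_ [_ [_ [_ [+ _]]]]]; apply.
    by apply: inSub_ev; rewrite kP_ty l2.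
  by apply/eqP => /rowP/(_ l); rewrite !mxE !eqxx => /eqP; rewrite oner_eq0.
rewrite lt_neqAle; apply/andP; split; last first.
  by rewrite -subr_ge0 -(nmulr_lle0 _ Bneg) -KE.
apply: contraNneq Alik => k21.
by rewrite (eq0 _ i k i0) // KE k21 subrr mul0r.
Qed.

(** The signs express Q through [B]: Q is [B] on p and -[B] on k. *)
Definition blk (u0 u1 u2 : R) a : R := if a == 0%N then u0 else if a == 1%N then - u1 else - u2.

Lemma gram_blocks (u0 u1 u2 : R) :
  gram (fun x y => u0 * Qres c pP x y + u1 * Qres c k1P x y + u2 * Qres c k2P x y)
  = diag_mx (\row_i blk u0 u1 u2 (ty i)) *m B.
Proof.
have prjE (P : pred 'I_N) i : prj P (ev R i) = if P i then ev R i else 0.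
  apply/rowP => k; rewrite !mxE; case: ifP => Pk; case: ifP => Pi; rewrite ?mxE //.
    by rewrite eqxx; case: eqP => // ki; rewrite ki Pi in Pk.
  by rewrite eqxx; case: eqP => // ki; rewrite ki Pi in Pk.
have prj0 (P : pred 'I_N) : prj P (0 : 'rV[R]_N) = 0.
  by apply/rowP => k; rewrite !mxE; case: ifP.
have k0l x : killing c 0 x = 0 by rewrite /killing linear0 mul0mx linear0.
have k0r x : killing c x 0 = 0 by rewrite killingC k0l.
apply/matrixP => i j; rewrite mul_diag_mx [LHS]mxE [RHS]mxE [X in _ = X * _]mxE.
have BE : killing c (ev R i) (ev R j) = B i j by rewrite mxE.
rewrite /Qres /Qform !prjE !pP_ty !k1P_ty !k2P_ty.
have [ij|ij] := eqVneq (ty i) (ty j); last first.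
  rewrite (killing_block Lc Cc Kc ij) in BE *.
  by case: (ty_cases R i) ij => -[-> _]; case: (ty_cases R j) => -[-> _] //= _;
     rewrite ?(prjE, prj0) ?(pP_ty, kP_ty) ?(k0l, k0r) ?subr0 ?mulr0 ?addr0.
case: (ty_cases R i) ij => -[i_ _] ij; rewrite -ij i_ /=;
  rewrite !(prjE, prj0) !(pP_ty, kP_ty) -?ij i_ /= !(k0l, k0r) BE /blk /=; ring.
Qed.

Lemma metricKE q : metricK c q = diag_mx (\row_i blk q.1.1 q.1.2 q.2 (ty i)) *m B.
Proof. exact: gram_blocks. Qed.

Lemma blk_neq0 q a : is_MK q -> blk q.1.1 q.1.2 q.2 a != 0.
Proof.
case=> q0 [q1 q2]; rewrite /blk; case: ifP => _; first by rewrite gt_eqF.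
by case: ifP => _; rewrite oppr_eq0 gt_eqF.
Qed.

Lemma trTE Tp T1 T2 q : is_MK q ->
  trT c Tp T1 T2 q = - (n%:R * Tp / q.1.1) + d1%:R * T1 / q.1.2 + d2%:R * T2 / q.2.
Proof.
move=> qM; rewrite /trT /trform metricKE /Ttensor gram_blocks.
rewrite (invmx_metric Bu) => [|i]; last exact: blk_neq0.
transitivity (\sum_(a < 3) blk (- Tp) T1 T2 a / blk q.1.1 q.1.2 q.2 a *
   \sum_(l : 'I_N | ty l == a) 1).
  rewrite -(sum_ty (fun a => blk (- Tp) T1 T2 a / blk q.1.1 q.1.2 q.2 a)).
  apply: eq_bigr => i _.
  transitivity (blk (- Tp) T1 T2 (ty i) / blk q.1.1 q.1.2 q.2 (ty i) * (J *m B) i i).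
    rewrite mxE mulr_sumr; apply: eq_bigr => j _.
    rewrite mul_mx_diag mul_diag_mx [X in X * _ = _]mxE [X in _ * X = _]mxE.
    rewrite ![(\row__ _) _ _]mxE; have -> : B j i = B i j by rewrite !mxE killingC.
    have [->|ij] := eqVneq (ty i) (ty j); first ring.
    by rewrite (killing_inv_block Lc Cc Kc ij); ring.
  by rewrite mulVmx // mxE eqxx.
case: qM => q0 [q1 q2].
rewrite !big_ord_recl big_ord0 /= !card_ty /blk /=.
by field; rewrite !gt_eqF.
Qed.

Lemma sum_tau (W : nat -> nat -> nat -> R) :
  \sum_i \sum_k \sum_l W (ty i) (ty k) (ty l) * tau c i k l =
  \sum_(e < 3) \sum_(b < 3) \sum_(a < 3) W a b e * Ttr c a b e.
Proof.
under eq_bigr => i _ do under eq_bigr => k _ do rewrite (sum_ty (W (ty i) (ty k))).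
under eq_bigr => i _ do rewrite exchange_big /=.
rewrite exchange_big /=; apply: eq_bigr => e _.
under eq_bigr => i _ do rewrite (sum_ty (fun b => W (ty i) b e)).
rewrite exchange_big /=; apply: eq_bigr => b _.
by rewrite (sum_ty (fun a => W a b e)).
Qed.

Lemma SfunE q : is_MK q -> Sfun c q =
  4%:R^-1 * (d1%:R * kappa1 / q.1.2 + d2%:R * kappa2 / q.2 - 2%:R * n%:R / q.1.1
   - (d1%:R * (1 - kappa1) * q.1.2 + d2%:R * (1 - kappa2) * q.2) / q.1.1 ^+ 2).
Proof.
move=> qM; rewrite /Sfun metricKE (scalE Lc Bu); last 2 first.
- by move=> i; exact: blk_neq0.
- exact: diag_ty_comm.
pose m := blk q.1.1 q.1.2 q.2.
rewrite (sum_tau (fun a b e => (m e ^+ 2 - (m a - m b) ^+ 2) / (m a * m b * m e))).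
(* Of the 27 triples of blocks only (1,1,1), (2,2,2) and the permutations of (0,0,1) and (0,0,2)
   contribute. *)
have Z a b e := @Ttr_forbidden _ _ _ _ c Lc Cc Kc a b e.
rewrite !big_ord_recl !big_ord0 /=.
rewrite (Z 0 0 0)%N // (Z 0 1 1)%N // (Z 0 1 2)%N // (Z 0 2 1)%N //.
rewrite (Z 0 2 2)%N // (Z 1 0 1)%N // (Z 1 0 2)%N // (Z 1 1 0)%N //.
rewrite (Z 1 1 2)%N // (Z 1 2 0)%N // (Z 1 2 1)%N // (Z 1 2 2)%N //.
rewrite (Z 2 0 1)%N // (Z 2 0 2)%N // (Z 2 1 0)%N // (Z 2 1 1)%N //.
rewrite (Z 2 1 2)%N // (Z 2 2 0)%N // (Z 2 2 1)%N //.
rewrite (TtrC Lc Cc Kc 1 0 0) (TtrC Lc Cc Kc 2 0 0) (TtrCr Lc Cc 0 1 0) (TtrCr Lc Cc 0 2 0).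
rewrite (Ttr_001 Lc Cc Kc kap1) (Ttr_002 Lc Cc Kc kap2).
rewrite (Ttr_111 Lc Cc Kc kap1) (Ttr_222 Lc Cc Kc kap2).
(* The 1 / beta term arises with coefficient -((1 - kappa_1) d_1 + (1 - kappa_2) d_2), which the
   Casimir identity equates with -n / 2. *)
rewrite -(casimir_p Lc Cc Kc kap1 kap2) /m /blk /=.
by case: qM => q0 [q1 q2]; field; rewrite !gt_eqF.
Qed.

End CurvatureFormula.

(** * Cubic polynomials with a double root *)

Section Cubic.
Variables (R : realFieldType) (a b cc d : R).
Hypothesis a_gt0 : 0 < a.
Implicit Types x y : R.

Definition cubic x := a * x ^+ 3 + b * x ^+ 2 + cc * x + d.
Definition cubic' x := 3%:R * a * x ^+ 2 + 2%:R * b * x + cc.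
Definition double_root x := cubic x = 0 /\ cubic' x = 0.
(* The third root when [x] is a double root. *)
Definition coroot x := - (b / a) - 2%:R * x.

Let a0 : a != 0. Proof. by rewrite gt_eqF. Qed.

Lemma cubic_taylor x y : cubic x = 0 ->
  cubic y = (y - x) * (cubic' x + (y - x) * (3%:R * a * x + b + a * (y - x))).
Proof. by move=> cx; rewrite -[LHS]subr0 -cx /cubic /cubic'; ring. Qed.

Lemma cubic_factor x y : double_root x -> cubic y = a * (y - x) ^+ 2 * (y - coroot x).
Proof. by case=> cx c'x; rewrite (cubic_taylor _ cx) c'x /coroot; field. Qed.

Let D := 18%:R * a * b * cc * d - 4%:R * b ^+ 3 * d + b ^+ 2 * cc ^+ 2
           - 4%:R * a * cc ^+ 3 - 27%:R * a ^+ 2 * d ^+ 2.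
Let Delta := b ^+ 2 - 3%:R * a * cc.
Let Rt := - (b / (3%:R * a)).
Let Rd := (9%:R * a * d - b * cc) / (2%:R * Delta).
Let Rs := (4%:R * a * b * cc - 9%:R * a ^+ 2 * d - b ^+ 3) / (a * Delta).

Lemma double_root_coef x : double_root x ->
  cc = - (3%:R * a * x ^+ 2 + 2%:R * b * x) /\ d = 2%:R * a * x ^+ 3 + b * x ^+ 2.
Proof.
rewrite /double_root /cubic /cubic' => -[cx c'x].
have cE : cc = - (3%:R * a * x ^+ 2 + 2%:R * b * x) by lra.
split=> //; rewrite cE in cx; apply/eqP; rewrite -subr_eq0 -cx; apply/eqP; ring.
Qed.

(** The right side is a^2 (x - s)^2 for the third root s, so b^2 = 3 a c characterises triple roots
    among double ones. *)
Lemma double_root_Delta x : double_root x -> Delta = (b + 3%:R * a * x) ^+ 2.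
Proof. by move=> /double_root_coef[cE dE]; rewrite /Delta cE; ring. Qed.

Lemma double_root_discr x : double_root x -> D = 0.
Proof. by move=> /double_root_coef[cE dE]; rewrite /D cE dE; ring. Qed.

Lemma double_root_Rt x : double_root x -> b ^+ 2 = 3%:R * a * cc ->
  x = Rt /\ coroot x = x.
Proof.
move=> rx /eqP; rewrite -subr_eq0 -/Delta (double_root_Delta rx) sqrf_eq0 => /eqP E.
have bE : b = - (3%:R * a * x) by lra.
by rewrite /Rt /coroot bE; split; field; rewrite ?a0 //.
Qed.

Lemma double_root_Rd x : double_root x -> b ^+ 2 != 3%:R * a * cc ->
  x = Rd /\ coroot x = Rs.
Proof.
move=> rx; rewrite -subr_eq0 -/Delta => D0.
have DE := double_root_Delta rx; rewrite DE sqrf_eq0 in D0.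
have [cE dE] := double_root_coef rx.
by rewrite /Rd /Rs DE cE dE /coroot; split; field; rewrite ?a0 ?D0.
Qed.

Lemma coroot_double x : double_root x -> coroot x = x -> b ^+ 2 = 3%:R * a * cc.
Proof.
move=> rx sx; apply/eqP; rewrite -subr_eq0 -/Delta (double_root_Delta rx) sqrf_eq0.
have -> : b = - (a * (coroot x + 2%:R * x)) by rewrite /coroot; field.
by rewrite sx; apply/eqP; ring.
Qed.

Lemma Rt_double_root : D = 0 -> b ^+ 2 = 3%:R * a * cc -> double_root Rt.
Proof.
move=> D0 bE; have cE : cc = b ^+ 2 / (3%:R * a) by rewrite bE; field.
(* Once c = b^2 / (3 a), the discriminant is minus this square over 27 a^2, so its vanishing
   determines d. *)
have : (27%:R * a ^+ 2 * d - b ^+ 3) ^+ 2 = 0.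
  transitivity (- (27%:R * a ^+ 2) * D); last by rewrite D0 mulr0.
  by rewrite /D cE; field.
move=> /eqP; rewrite sqrf_eq0 subr_eq0 => /eqP dE.
have {}dE : d = b ^+ 3 / (27%:R * a ^+ 2) by rewrite -dE; field.
by split; rewrite /cubic /cubic' /Rt ?dE cE; field.
Qed.

Lemma Rd_double_root : D = 0 -> b ^+ 2 != 3%:R * a * cc -> double_root Rd.
Proof.
move=> D0; rewrite -subr_eq0 -/Delta => De0.
have c'0 : cubic' Rd = 0.
  transitivity (- (9%:R * a * D) / (4%:R * Delta ^+ 2)); last by rewrite D0 mulr0 oppr0 mul0r.
  rewrite /cubic' /Rd /D; have := De0; rewrite /Delta => De0'.
  by field.
split=> //.
(* Euclidean division of the cubic by its derivative; [Rd] is the zero of the linear remainder. *)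
transitivity (cubic' Rd * (Rd / 3%:R + b / (9%:R * a)) - 2%:R * Delta / (9%:R * a) * Rd
   + (9%:R * a * d - b * cc) / (9%:R * a)).
  by rewrite /cubic /cubic' /Delta; field.
by rewrite c'0 /Rd; field; rewrite De0 a0.
Qed.

Lemma double_rootP x : double_root x <->
  (D = 0 /\ b ^+ 2 = 3%:R * a * cc /\ x = Rt /\ coroot x = x) \/
  (D = 0 /\ b ^+ 2 != 3%:R * a * cc /\ x = Rd /\ coroot x = Rs).
Proof.
split=> [rx|[[D0 [bE [-> _]]]|[D0 [bE [-> _]]]]]; last 2 first.
- exact: Rt_double_root.
- exact: Rd_double_root.
have D0 := double_root_discr rx.
have [bE|bE] := eqVneq (b ^+ 2) (3%:R * a * cc); [left|right].
  by have [? ?] := double_root_Rt rx bE.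
by have [? ?] := double_root_Rd rx bE.
Qed.

Lemma double_root_uniq x y : double_root x -> double_root y -> x = y.
Proof.
move=> /double_rootP [[_ [e1 [-> _]]]|[_ [e1 [-> _]]]] /double_rootP;
  move=> [[_ [e2 [-> _]]]|[_ [e2 [-> _]]]] //.
  by rewrite e1 eqxx in e2.
by rewrite e2 eqxx in e1.
Qed.

Lemma Rd_coroot : D = 0 -> b ^+ 2 != 3%:R * a * cc -> coroot Rd = Rs.
Proof. by move=> D0 bE; have [] := double_root_Rd (Rd_double_root D0 bE) bE. Qed.

Lemma Rt_coroot : D = 0 -> b ^+ 2 = 3%:R * a * cc -> coroot Rt = Rt.
Proof. by move=> D0 bE; have [] := double_root_Rt (Rt_double_root D0 bE) bE. Qed.

(* [sg] is [1] or [-1], so that local maxima and minima are treated at once. *)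
Lemma cubic_one_signed (sg : R) x : `|sg| = 1 ->
  (cubic x = 0 /\ exists del : R, 0 < del /\
     forall y, `|y - x| < del -> 0 <= sg * cubic y) <->
  (double_root x /\ 0 < sg * (x - coroot x)).
Proof.
move=> sg1; have sg2 : sg = 1 \/ sg = -1.
  by move/eqP: sg1; rewrite eqr_norml => /andP[/orP[]/eqP]; [left|right].
split=> [[cx [del [del0 H]]]|[rx s0]]; last first.
  split; first by case: rx.
  exists `|x - coroot x|; split.
    by rewrite normr_gt0; apply: contraTneq s0 => ->; rewrite mulr0 ltxx.
  move=> y yx; rewrite (cubic_factor _ rx) mulrCA; apply: mulr_ge0.
    by rewrite mulr_ge0 ?sqr_ge0 // ltW.
  move: yx; rewrite ltr_norml => /andP[]; case: sg2 s0 => ->.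
    by rewrite !mul1r => s0; rewrite gtr0_norm // => ? ?; lra.
  by rewrite !mulN1r oppr_gt0 => s0; rewrite ltr0_norm // => ? ?; lra.
have rx : double_root x.
  split=> //; apply/eqP/negPn/negP => p0.
  set p := cubic' x in p0 *; pose m := 3%:R * a * x + b.
  (* For 0 < h <= 1, [K] bounds the second-order part of the expansion by h K. With h K < |p| the
     sign of [p] prevails on both sides, and the cubic changes sign at [x]. *)
  pose K := `|m| + a + 1.
  have K0 : 0 < K by rewrite /K ltr_wpDl // addr_ge0 // ltW.
  pose h := Num.min (del / 2%:R) (Num.min 1 (`|p| / (2%:R * K))).
  have h0 : 0 < h.
    rewrite !lt_min ltr01 divr_gt0 //= divr_gt0 ?normr_gt0 //; lra.
  have h1 : h <= 1 by rewrite !ge_min lexx orbT.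
  have hd : h < del by apply: (le_lt_trans (y := del / 2%:R)); [rewrite ge_min lexx|lra].
  have hp : h * K < `|p|.
    have : h <= `|p| / (2%:R * K) by rewrite !ge_min lexx !orbT.
    rewrite ler_pdivlMr; last by lra.
    have p_gt0 : 0 < `|p| by rewrite normr_gt0.
    by rewrite mulrCA mulr_natl mulr2n => ?; have := mulr_gt0 h0 K0; lra.
  have Hp : 0 <= sg * (p + h * (m + a * h)).
    have := H (x + h); rewrite (cubic_taylor _ cx) [x + h]addrC addrK gtr0_norm // => /(_ hd).
    by rewrite mulrCA pmulr_rge0.
  have Hn : sg * (p - h * (m - a * h)) <= 0.
    have := H (x - h); rewrite (cubic_taylor _ cx) [x - h]addrC addrK.
    rewrite normrN gtr0_norm // => /(_ hd).
    by rewrite mulrCA mulNr oppr_ge0 pmulr_rle0 // mulNr mulrN.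
  have hm1 : h * m <= h * `|m| by rewrite ler_pM2l // ler_norm.
  have hm2 : - (h * `|m|) <= h * m by rewrite -mulrN ler_pM2l // lerNl -normrN ler_norm.
  have hh : h * (a * h) <= h * a by rewrite ler_pM2l // -[leRHS]mulr1 ler_pM2l.
  have hh0 : 0 <= h * (a * h) by rewrite !mulr_ge0 // ltW.
  have KE : h * K = h * `|m| + h * a + h by rewrite /K; ring.
  rewrite KE in hp.
  have [p_gt0|p_lt0|pE] := ltrgt0P p; last by rewrite pE eqxx in p0.
    by move: hp Hp Hn; rewrite (gtr0_norm p_gt0); case: sg2 => ->; lra.
  by move: hp Hp Hn; rewrite (ltr0_norm p_lt0); case: sg2 => ->; lra.
split=> //; rewrite ltNge; apply/negP => s_le0.
(* Up to a positive factor, the signed cubic near [x] is sg (y - x + e). For e = 0 it changes sign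
   at [x]; if sg e < 0, a point at distance at most |e| / 2 contradicts nonnegativity. *)
pose e := x - coroot x; rewrite -/e in s_le0.
have key y : `|y - x| < del -> y != x -> 0 <= sg * (y - x + e).
  move=> yd yx; have := H y yd; rewrite (cubic_factor _ rx) mulrCA pmulr_rge0.
    by rewrite /e addrA subrK.
  by rewrite mulr_gt0 // exprn_even_gt0 //= subr_eq0.
have [e0|e0] := eqVneq e 0.
  have h0 : 0 < del / 2%:R by lra.
  have hd : `|del / 2%:R| < del by rewrite gtr0_norm //; lra.
  have k1 := key (x + del / 2%:R); have k2 := key (x - del / 2%:R).
  move: k1 k2; rewrite e0 [x + _]addrC [x - _]addrC !addrK !addr0 normrN.
  move=> /(_ hd) k1 /(_ hd) k2.
  have {}k1 : 0 <= sg * (del / 2%:R).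
    by apply: k1; rewrite -subr_eq0 addrK gt_eqF.
  have {}k2 : 0 <= sg * - (del / 2%:R).
    by apply: k2; rewrite -subr_eq0 addrK oppr_eq0 gt_eqF.
  by move: k1 k2; case: sg2 => ->; lra.
have se : sg * e < 0.
  rewrite lt_neqAle s_le0 andbT mulf_neq0 //.
  by rewrite -normr_gt0 sg1.
pose h := Num.min (del / 2%:R) (`|e| / 2%:R).
have h0 : 0 < h by rewrite lt_min !divr_gt0 // normr_gt0.
have hd : h < del by apply: (le_lt_trans (y := del / 2%:R)); [rewrite ge_min lexx|lra].
have he : h <= `|e| / 2%:R by rewrite ge_min lexx orbT.
have := key (x + h); rewrite [x + h]addrC addrK gtr0_norm // => /(_ hd).
rewrite -subr_eq0 addrK gt_eqF // => /(_ isT).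
have [e_gt0|e_lt0|eE] := ltrgt0P e; last by rewrite eE eqxx in e0.
  by move: he se; rewrite (gtr0_norm e_gt0); case: sg2 => ->; lra.
by move: he se; rewrite ltr0_norm //; case: sg2 => ->; lra.
Qed.

Lemma cubic_nonneg_beyond x x0 : x0 < x ->
  (cubic x = 0 /\ forall y, x0 < y -> 0 <= cubic y) <->
  (double_root x /\ coroot x <= x0).
Proof.
move=> x0x; split=> [[cx H]|[rx s0]]; last first.
  split=> [|y x0y]; first by case: rx.
  rewrite (cubic_factor _ rx); apply: mulr_ge0; last lra.
  by rewrite mulr_ge0 ?sqr_ge0 // ltW.
have [] := (cubic_one_signed x (normr1 R)).1.
  split=> //; exists (x - x0); rewrite subr_gt0; split=> // y; rewrite mul1r.
  by rewrite ltr_norml => /andP[h _]; apply: H; lra.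
rewrite mul1r subr_gt0 => rx sx; split=> //; rewrite leNgt; apply/negP => x0s.
(* If the third root exceeded [x0], the cubic would be negative just below it, still inside the
   ray. *)
pose y := (x0 + coroot x) / 2%:R.
have ys : y < coroot x by rewrite /y; lra.
have /H : x0 < y by rewrite /y; lra.
rewrite (cubic_factor _ rx) leNgt => /negP; apply.
rewrite pmulr_rlt0 ?subr_lt0 //.
by rewrite mulr_gt0 // exprn_even_gt0 //= subr_eq0 lt_eqF // (lt_trans ys).
Qed.

Lemma cubic_unbounded x0 : exists2 y, x0 < y & 0 < cubic y.
Proof.
pose K := `|b| + `|cc| + `|d|.
have K0 : 0 <= K by rewrite !addr_ge0.
pose y := 1 + `|x0| + K / a.
have Ka : 0 <= K / a by rewrite divr_ge0 // ltW.
have y1 : 1 <= y by rewrite /y -addrA lerDl addr_ge0.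
exists y; first by rewrite /y; have := ler_norm x0; lra.
have ay : K < a * y.
  rewrite /y !mulrDr mulr1 [a * (K / a)]mulrC divfK //.
  by rewrite ltrDr ltr_wpDr // mulr_ge0 // ltW.
have y2 : 1 <= y ^+ 2 by rewrite exprn_ege1.
have yy : y <= y ^+ 2 by rewrite expr2 ler_peMr //; lra.
have B1 : - (`|b| * y ^+ 2) <= b * y ^+ 2.
  by rewrite -mulNr ler_pM2r; [rewrite lerNl -normrN ler_norm|lra].
have B2 : - (`|cc| * y ^+ 2) <= cc * y.
  apply: (le_trans (y := - (`|cc| * y))).
    by rewrite lerN2; apply: ler_wpM2l.
  by rewrite -mulNr ler_pM2r; [rewrite lerNl -normrN ler_norm|lra].
have B3 : - (`|d| * y ^+ 2) <= d.
  apply: (le_trans (y := - `|d|)); first by rewrite lerN2 ler_peMr.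
  by rewrite lerNl -normrN ler_norm.
have : K * y ^+ 2 < a * y ^+ 3.
  by rewrite (_ : a * y ^+ 3 = a * y * y ^+ 2) ?ltr_pM2r //; [lra|ring].
by rewrite /cubic /K !mulrDl => ?; lra.
Qed.

End Cubic.

(** * Directional derivatives along [M_K] *)

Section DirectionalDerivative.
Variable R : realType.
Implicit Types (q v : R * R * R) (a b e : R).

Lemma affine_cvg0 a b : ((fun t : R => a + t * b) t @[t --> (0 : R)] --> a)%classic.
Proof.
rewrite -[X in (_ --> X)%classic]addr0 -[in X in (_ --> X)%classic](mul0r b).
apply: cvgD; first exact: cvg_cst.
by apply: cvgM; [exact: cvg_id|exact: cvg_cst].
Qed.

Lemma affine_near_gt0 a b : 0 < a -> \forall t \near (0 : R), 0 < a + t * b.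
Proof. by move=> a0; have /cvgr_gt := @affine_cvg0 a b; apply. Qed.

Lemma shift_near_MK q v : is_MK q -> \forall t \near (0 : R), is_MK (Defs.shift q t v).
Proof.
case=> q0 [q1 q2]; near=> t; split; [|split].
- by near: t; exact: affine_near_gt0.
- by near: t; exact: affine_near_gt0.
- by near: t; exact: affine_near_gt0.
Unshelve. all: by end_near. Qed.

(* Both the scalar curvature and the trace of [T] have this shape. *)
Definition ratfun (C0 C1 C2 E1 E2 : R) q : R :=
  C0 / q.1.1 + C1 / q.1.2 + C2 / q.2 + (E1 * q.1.2 + E2 * q.2) / q.1.1 ^+ 2.

Definition dratfun (C0 C1 C2 E1 E2 : R) q v : R :=
  - (C0 * v.1.1 / q.1.1 ^+ 2) - C1 * v.1.2 / q.1.2 ^+ 2 - C2 * v.2 / q.2 ^+ 2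
  + (E1 * v.1.2 + E2 * v.2) / q.1.1 ^+ 2
  - 2%:R * (E1 * q.1.2 + E2 * q.2) * v.1.1 / q.1.1 ^+ 3.

Lemma is_derive_affine a b : is_derive (0 : R) (1 : R) (fun t : R => a + t * b) b.
Proof.
have H : is_derive (0 : R) (1 : R) ((cst a : R -> R) + (id : R -> R) * cst b)
    (0 + ((0 : R) *: (0 : R) + b *: (1 : R))).
  by apply: is_deriveD; apply: is_deriveM.
by apply: is_derive_eq H _; rewrite /GRing.scale /= mul0r !add0r mulr1.
Qed.

Lemma is_derive_affineV a b : 0 < a ->
  is_derive (0 : R) (1 : R) (fun t : R => (a + t * b)^-1) (- (b / a ^+ 2)).
Proof.
move=> a0; have H : a + 0 * b != 0 by rewrite mul0r addr0 gt_eqF.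
have := @is_deriveV R (fun t => a + t * b) 0 b 1 H (is_derive_affine a b).
move=> D; apply: is_derive_eq D _.
by rewrite /GRing.scale /= mul0r addr0 mulNr mulrC.
Qed.

Lemma is_derive_ratfun (C0 C1 C2 E1 E2 : R) q v : is_MK q ->
  is_derive (0 : R) (1 : R) (fun t => ratfun C0 C1 C2 E1 E2 (Defs.shift q t v))
    (dratfun C0 C1 C2 E1 E2 q v).
Proof.
case: q => [[q0 q1] q2]; case: v => [[v0 v1] v2] [/= q0p [q1p q2p]].
have d0 := is_derive_affineV v0 q0p.
have d1 := is_derive_affineV v1 q1p.
have d2 := is_derive_affineV v2 q2p.
have a1 := is_derive_affine q1 v1.
have a2 := is_derive_affine q2 v2.
have k (a : R) : is_derive (0 : R) (1 : R) (cst a : R -> R) 0 by exact: is_derive_cst.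
have D := is_deriveD (is_deriveD (is_deriveD (is_deriveM (k C0) d0)
  (is_deriveM (k C1) d1)) (is_deriveM (k C2) d2)) (is_deriveM (is_deriveD
  (is_deriveM (k E1) a1) (is_deriveM (k E2) a2)) (is_deriveM d0 d0)).
have -> : (fun t => ratfun C0 C1 C2 E1 E2 (Defs.shift (q0, q1, q2) t (v0, v1, v2))) =
    (cst C0 : R -> R) * (fun t => (q0 + t * v0)^-1)
    + (cst C1 : R -> R) * (fun t => (q1 + t * v1)^-1)
    + (cst C2 : R -> R) * (fun t => (q2 + t * v2)^-1)
    + ((cst E1 : R -> R) * (fun t => q1 + t * v1) + (cst E2 : R -> R) * (fun t => q2 + t * v2))
      * ((fun t => (q0 + t * v0)^-1) * (fun t => (q0 + t * v0)^-1)).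
  by apply/funext => t; rewrite /ratfun /Defs.shift /= expr2 invfM.
apply: is_derive_eq D _; rewrite /dratfun /cst !fctE !mul0r !addr0 /GRing.scale /=.
by field; rewrite !gt_eqF.
Qed.

(** The formula for [f] holds on M_K only; M_K is open in the parameters, so it holds near t = 0
    along every line. *)
Lemma has_dirderiv_ratfun (f : R * R * R -> R) (C0 C1 C2 E1 E2 : R) q v l :
  (forall q', is_MK q' -> f q' = ratfun C0 C1 C2 E1 E2 q') -> is_MK q ->
  has_dirderiv f q v l <-> l = dratfun C0 C1 C2 E1 E2 q v.
Proof.
move=> fE qM; have [der val] : is_derive (0 : R) (1 : R) (fun t => f (Defs.shift q t v))
    (dratfun C0 C1 C2 E1 E2 q v).
  apply: near_eq_is_derive (is_derive_ratfun C0 C1 C2 E1 E2 v qM).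
  by near=> t; rewrite fE //; near: t; exact: shift_near_MK.
rewrite /has_dirderiv derive1E val; split=> [[_ <-]//|->].
by split.
Unshelve. all: by end_near. Qed.

End DirectionalDerivative.

(** * Reduction to a cubic in [alpha_2 / beta] *)

Section Reduction.
Variables (R : realType) (n d1 d2 : nat).
Variable c : 'I_(n + d1 + d2) -> 'I_(n + d1 + d2) -> 'rV[R]_(n + d1 + d2).
Variables (k1 k2 Tp T1 T2 : R).
Hypothesis Tp0 : 0 < Tp.
Hypothesis T10 : 0 < T1.
Hypothesis T20 : 0 < T2.
Hypothesis n0 : (0 < n)%N.
Hypothesis d10 : (0 < d1)%N.
Hypothesis d20 : (0 < d2)%N.
Hypothesis k2lt1 : k2 < 1.
Let nu : R := n%:R.
Let e1 : R := d1%:R.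
Let e2 : R := d2%:R.
Hypothesis TE : forall q, is_MK q ->
  trT c Tp T1 T2 q = - (nu * Tp / q.1.1) + e1 * T1 / q.1.2 + e2 * T2 / q.2.
Hypothesis SE : forall q, is_MK q -> Sfun c q =
  4%:R^-1 * (e1 * k1 / q.1.2 + e2 * k2 / q.2 - 2%:R * nu / q.1.1
   - (e1 * (1 - k1) * q.1.2 + e2 * (1 - k2) * q.2) / q.1.1 ^+ 2).

Let nu0 : 0 < nu. Proof. by rewrite ltr0n. Qed.
Let e10 : 0 < e1. Proof. by rewrite ltr0n. Qed.
Let e20 : 0 < e2. Proof. by rewrite ltr0n. Qed.

Definition ca : R := n%:R * d2%:R * (1 - k2) * Tp.
Definition cb : R := d1%:R ^+ 2 * (1 - k1) * T1 - d2%:R ^+ 2 * (1 - k2) * T2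
           + 2%:R * n%:R ^+ 2 * Tp - n%:R ^+ 2 * k1 * Tp ^+ 2 / T1.
Definition ccc : R := - (2%:R * n%:R * d2%:R * T2) + 2%:R * n%:R * d2%:R * k1 * Tp * T2 / T1
            - n%:R * d2%:R * k2 * Tp.
Definition cd : R := - (d2%:R ^+ 2 * k1 * T2 ^+ 2 / T1) + k2 * d2%:R ^+ 2 * T2.
Let P := cubic ca cb ccc cd.
Let P' := cubic' ca cb ccc.
Let x0 : R := e2 * T2 / (nu * Tp).
(** On M_T^0 one has alpha_1 = d_1 T_1 beta x / u(x), so that positivity of alpha_1 means u(x) > 0,
    that is x > x0. *)
Let u (x : R) := nu * Tp * x - e2 * T2.

Lemma ca_gt0 : 0 < ca.
Proof. by rewrite /ca !mulr_gt0 ?subr_gt0. Qed.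

(* The metric of [M_T^0] with [q.1.1 = beta] and [q.2 / q.1.1 = x]. *)
Definition pt (beta x : R) : R * R * R :=
  (beta, d1%:R * T1 * beta * x / (n%:R * Tp * x - d2%:R * T2), beta * x).

Lemma x0_gt0 : 0 < x0. Proof. by rewrite divr_gt0 ?mulr_gt0. Qed.

Lemma u_gt0 x : (0 < u x) = (x0 < x).
Proof. by rewrite /u /x0 ltr_pdivrMr ?mulr_gt0 // subr_gt0 [x * _]mulrC. Qed.

Lemma x_gt0 x : x0 < x -> 0 < x. Proof. exact: lt_trans x0_gt0. Qed.

Lemma pt_MT0 b x : 0 < b -> x0 < x -> in_MT0 c Tp T1 T2 (pt b x).
Proof.
move=> b0 xx; have u0 : 0 < u x by rewrite u_gt0.
have x_0 := x_gt0 xx.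
have M : is_MK (pt b x).
  split=> //; split; last exact: mulr_gt0.
  by apply: divr_gt0 => //; rewrite !mulr_gt0.
split=> //; rewrite TE // /pt /= -/nu -/e1 -/e2 -/(u x).
have -> : e1 * T1 / (e1 * T1 * b * x / u x) = u x / (b * x).
  by field; rewrite !gt_eqF.
by rewrite /u; field; rewrite !gt_eqF.
Qed.

Lemma MT0_pt q : in_MT0 c Tp T1 T2 q ->
  [/\ 0 < q.1.1, x0 < q.2 / q.1.1 & q = pt q.1.1 (q.2 / q.1.1)].
Proof.
case: q => [[b a1] a2] [M]; rewrite TE //; case: M => /= [b0 [a10 a20]] E.
have uE : u (a2 / b) = e1 * T1 * a2 / a1.
  apply/eqP; rewrite -subr_eq0; apply/eqP.
  transitivity (- a2 * (- (nu * Tp / b) + e1 * T1 / a1 + e2 * T2 / a2)); last by rewrite E mulr0.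
  by rewrite /u; field; rewrite !gt_eqF.
have u0 : 0 < u (a2 / b) by rewrite uE divr_gt0 // !mulr_gt0.
split=> //; first by rewrite -u_gt0.
rewrite /pt -/nu -/e1 -/e2 -/(u _) uE.
have -> : e1 * T1 * b * (a2 / b) / (e1 * T1 * a2 / a1) = a1 by field; rewrite !gt_eqF.
by rewrite mulrC divfK ?gt_eqF.
Qed.

Lemma Sfun_pt b x : 0 < b -> x0 < x -> Sfun c (pt b x) = - P x / (4%:R * b * x * u x).
Proof.
move=> b0 xx; have [M _] := pt_MT0 b0 xx; rewrite SE // /pt /= -/nu -/e1 -/e2 -/(u x).
have u0 : 0 < u x by rewrite u_gt0.
have x_0 := x_gt0 xx.
rewrite /P /cubic /ca /cb /ccc /cd -/nu -/e1 -/e2.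
have u1 : u x != 0 by rewrite gt_eqF.
by move: u1; rewrite /u => u1; field; rewrite u1 !gt_eqF.
Qed.

Let den_gt0 b x : 0 < b -> x0 < x -> 0 < 4%:R * b * x * u x.
Proof. by move=> b0 xx; rewrite !mulr_gt0 ?u_gt0 // x_gt0. Qed.

Lemma Sfun_pt_sign sg b x : 0 < b -> x0 < x -> (sg * Sfun c (pt b x) <= 0) = (0 <= sg * P x).
Proof.
move=> b0 xx; rewrite Sfun_pt // mulrA pmulr_lle0 ?invr_gt0 ?den_gt0 //.
by rewrite mulrN oppr_le0.
Qed.

Lemma Sfun_pt_eq0 b x : 0 < b -> x0 < x -> Sfun c (pt b x) = 0 <-> P x = 0.
Proof.
move=> b0 xx; rewrite Sfun_pt //; split=> [/eqP|->]; last by rewrite oppr0 mul0r.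
by rewrite mulf_eq0 invr_eq0 oppr_eq0 [X in _ || X]gt_eqF ?den_gt0 // orbF => /eqP.
Qed.

Lemma pt_near b x e : 0 < b -> x0 < x -> 0 < e ->
  exists del : R, 0 < del /\ forall y, `|y - x| < del -> x0 < y /\ near_q e (pt b x) (pt b y).
Proof.
move=> b0 xx e0.
have ux : u x != 0 by rewrite gt_eqF // u_gt0.
have cu : (u y @[y --> x] --> u x)%classic.
  by apply: cvgB; [apply: cvgM; [exact: cvg_cst|exact: cvg_id]|exact: cvg_cst].
have c1 : (e1 * T1 * b * y / u y @[y --> x] --> e1 * T1 * b * x / u x)%classic.
  apply: cvgM; last exact: cvgV.
  by apply: cvgM; [exact: cvg_cst|exact: cvg_id].
have c2 : (b * y @[y --> x] --> b * x)%classic.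
  by apply: cvgM; [exact: cvg_cst|exact: cvg_id].
have : \forall y \near x, x0 < y /\ near_q e (pt b x) (pt b y).
  near=> y; split; first by near: y; exact: lt_nbhsr.
  split; first by rewrite /= subrr normr0.
  split; rewrite distrC.
    by near: y; move/cvgrPdist_lt : c1; exact.
  by near: y; move/cvgrPdist_lt : c2; exact.
move=> /nbhs_normP[del /= del0 H]; exists del; split=> // y yx.
by apply: H => /=; rewrite distrC.
Unshelve. all: by end_near. Qed.

(* [sg] is [1] for maxima and [-1] for minima. Scaling a metric by [t] divides
   its scalar curvature by [t], so that the curvature vanishes at an extremum. *)
Lemma local_extremum_pt sg b x : `|sg| = 1 -> 0 < b -> x0 < x ->
  (exists e : R, 0 < e /\ forall q', in_MT0 c Tp T1 T2 q' -> near_q e (pt b x) q' ->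
     sg * Sfun c q' <= sg * Sfun c (pt b x)) <->
  (P x = 0 /\ exists del : R, 0 < del /\ forall y, `|y - x| < del -> 0 <= sg * P y).
Proof.
move=> sg1 b0 xx; split=> [[e [e0 H]]|[Px [del [del0 H]]]].
  have S0 : Sfun c (pt b x) = 0.
    have [[/= _ [a10 a20]] _] := pt_MT0 b0 xx.
    set a1 := _ / _ in a10; set a2 := b * x in a20.
    (* [K] exceeds every coordinate, so scaling by 1 + h or 1 - h with h = e / K moves each by less
       than [e]; the summand [e] ensures h < 1. The two scalings give opposite inequalities for
       S. *)
    pose K := b + a1 + a2 + e.
    have K0 : 0 < K by rewrite /K !addr_gt0.
    pose h := e / K; have h0 : 0 < h by rewrite divr_gt0.
    have hlt (z : R) : 0 < z -> z < K -> h * z < e.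
      move=> z0 zK; rewrite /h mulrAC ltr_pdivrMr // mulrC [e * K]mulrC ltr_pM2r //.
    have h1 : h < 1 by rewrite ltr_pdivrMr // mul1r /K ltrDr !addr_gt0.
    have Ht t : `|t - 1| = h -> 0 < t -> sg * Sfun c (pt b x) / t <= sg * Sfun c (pt b x).
      move=> th t0; have tb0 : 0 < t * b by rewrite mulr_gt0.
      have := H _ (pt_MT0 tb0 xx).
      rewrite !Sfun_pt //.
      have -> : sg * (- P x / (4%:R * (t * b) * x * u x)) =
         sg * (- P x / (4%:R * b * x * u x)) / t.
        by field; rewrite !gt_eqF ?u_gt0 // x_gt0.
      apply; have dist (z : R) : 0 < z -> z < K -> `|t * z - z| < e.
        move=> z0 zK; rewrite -[X in _ - X]mul1r -mulrBl normrM th (gtr0_norm z0).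
        exact: hlt.
      split=> /=; first by apply: dist => //; rewrite /K; lra.
      split; last by rewrite -mulrA; apply: dist => //; rewrite /K -/a2; lra.
      have -> : d1%:R * T1 * (t * b) * x / (n%:R * Tp * x - d2%:R * T2) = t * a1.
        by rewrite /a1; field; rewrite gt_eqF // -/nu -/e2 -/(u x) u_gt0.
      by rewrite -/a1; apply: dist => //; rewrite /K; lra.
    have Hp : sg * Sfun c (pt b x) / (1 + h) <= sg * Sfun c (pt b x).
      by apply: Ht; [rewrite addrAC subrr add0r gtr0_norm|rewrite addr_gt0].
    have Hn : sg * Sfun c (pt b x) / (1 - h) <= sg * Sfun c (pt b x).
      by apply: Ht; [rewrite addrAC subrr sub0r normrN gtr0_norm|rewrite subr_gt0].
    rewrite ler_pdivrMr ?addr_gt0 // mulrDr mulr1 in Hp.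
    rewrite ler_pdivrMr ?subr_gt0 // mulrBr mulr1 in Hn.
    have : sg * Sfun c (pt b x) * h = 0 by lra.
    move/eqP; rewrite mulf_eq0 (gt_eqF h0) orbF mulf_eq0 -[sg == 0]normr_eq0 sg1 oner_eq0 /=.
    by move/eqP.
  split; first by apply/(Sfun_pt_eq0 b0 xx).
  have [del [del0 D]] := pt_near b0 xx e0.
  exists del; split=> // y /D[x0y yq].
  rewrite -(Sfun_pt_sign _ b0 x0y); apply: le_trans (H _ (pt_MT0 b0 x0y) yq) _.
  by rewrite S0 mulr0.
have S0 : Sfun c (pt b x) = 0 by apply/(Sfun_pt_eq0 b0 xx).
have x_0 := x_gt0 xx.
(* The first bound keeps b' > b / 2; the second makes |a2' - b x| + x |b' - b| smaller than del b /
   2. Together they put the ratio a2' / b' within [del] of [x]. *)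
pose e := Num.min (b / 2%:R) (del * b / (2%:R * (1 + x))).
have e0 : 0 < e by rewrite lt_min !divr_gt0 ?mulr_gt0 ?addr_gt0.
have eb : e <= b / 2%:R by rewrite ge_min lexx.
have ed : e * (1 + x) <= del * b / 2%:R.
  have : e <= del * b / (2%:R * (1 + x)) by rewrite ge_min lexx orbT.
  rewrite ler_pdivlMr ?mulr_gt0 ?addr_gt0 //; lra.
exists e; split=> // q' /MT0_pt; case: q' => [[b' a1'] a2'] /= [b'0 yx q'E] [] /=.
rewrite {}q'E => hb [_ ha]; rewrite S0 mulr0 Sfun_pt_sign //; apply: H.
have b'b : b / 2%:R < b' by move: hb; rewrite ltr_norml => /andP[]; lra.
have -> : a2' / b' - x = ((a2' - b * x) - x * (b' - b)) / b' by field; rewrite gt_eqF.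
rewrite normrM [X in _ * X]gtr0_norm ?invr_gt0 // ltr_pdivrMr //.
apply: (le_lt_trans (ler_normB _ _)); rewrite normrM (gtr0_norm x_0).
have h1 : x * `|b' - b| < x * e by rewrite ltr_pM2l.
have h2 : del * (b / 2%:R) < del * b' by rewrite ltr_pM2l.
rewrite mulrA in h2; rewrite mulrDr mulr1 [e * x]mulrC in ed.
apply: lt_trans h2; apply: lt_le_trans ed; exact: ltrD.
Qed.

Let dbl := double_root ca cb ccc cd.
Let s := coroot ca cb.

Lemma local_max_pt b x : 0 < b -> x0 < x ->
  local_max_MT0 c Tp T1 T2 (pt b x) <-> dbl x /\ s x < x.
Proof.
move=> b0 xx; rewrite -subr_gt0 -[_ - _]mul1r -(cubic_one_signed _ _ _ ca_gt0 _ (normr1 R)).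
rewrite -(local_extremum_pt (normr1 R) b0 xx); split=> [[_ [e [e0 H]]]|[e [e0 H]]].
  by exists e; split=> // q' h1 h2; rewrite !mul1r; exact: H.
by split; [exact: pt_MT0|exists e; split=> // q' h1 h2; have := H q' h1 h2; rewrite !mul1r].
Qed.

Lemma local_min_pt b x : 0 < b -> x0 < x ->
  local_min_MT0 c Tp T1 T2 (pt b x) <-> dbl x /\ x < s x.
Proof.
have sg1 : `|-1 : R| = 1 by rewrite normrN normr1.
move=> b0 xx; rewrite -subr_gt0 -opprB -mulN1r -(cubic_one_signed _ _ _ ca_gt0 _ sg1).
rewrite -(local_extremum_pt sg1 b0 xx); split=> [[_ [e [e0 H]]]|[e [e0 H]]].
  by exists e; split=> // q' h1 h2; rewrite !mulN1r lerN2; exact: H.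
by split; [exact: pt_MT0|exists e; split=> // q' h1 h2; have := H q' h1 h2; rewrite !mulN1r lerN2].
Qed.

Lemma global_local_max q : global_max_MT0 c Tp T1 T2 q -> local_max_MT0 c Tp T1 T2 q.
Proof. by case=> qM H; split=> //; exists 1; split=> // q' h _; exact: H. Qed.

Lemma global_local_min q : global_min_MT0 c Tp T1 T2 q -> local_min_MT0 c Tp T1 T2 q.
Proof. by case=> qM H; split=> //; exists 1; split=> // q' h _; exact: H. Qed.

Lemma global_max_pt b x : 0 < b -> x0 < x ->
  global_max_MT0 c Tp T1 T2 (pt b x) <-> dbl x /\ s x <= x0.
Proof.
move=> b0 xx; rewrite -(cubic_nonneg_beyond _ _ _ ca_gt0 xx) -/P; split=> [G|[Px H]].
  have [[Px _] _] := (local_max_pt b0 xx).1 (global_local_max G).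
  split=> // y x0y; rewrite -[P y]mul1r -(Sfun_pt_sign 1 ltr01 x0y) mul1r.
  have [_ /(_ _ (pt_MT0 ltr01 x0y))] := G.
  by rewrite ((Sfun_pt_eq0 b0 xx).2 Px).
split; first exact: pt_MT0.
move=> q' /MT0_pt[b'0 yx ->]; rewrite ((Sfun_pt_eq0 b0 xx).2 Px).
by rewrite -[Sfun _ _]mul1r Sfun_pt_sign // mul1r H.
Qed.

(** S would vanish at a global minimum, but it is negative wherever the cubic is positive, which
    happens for large x because a > 0. *)
Lemma no_global_min : ~ exists q, global_min_MT0 c Tp T1 T2 q.
Proof.
move=> [q G]; have [b0 xx qE] := MT0_pt G.1; rewrite qE in G.
have [[Px _] _] := (local_min_pt b0 xx).1 (global_local_min G).
have [y x0y] := cubic_unbounded cb ccc cd ca_gt0 x0; rewrite ltNge => /negP; apply.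
have [_ /(_ _ (pt_MT0 ltr01 x0y))] := G.
rewrite ((Sfun_pt_eq0 b0 xx).2 Px) -oppr_le0 -mulN1r Sfun_pt_sign //.
by rewrite mulN1r oppr_ge0.
Qed.

(** The tangent plane is spanned by the point itself and by [w]. Along the point the derivative of S
    is -S (Euler's identity for degree -1); along [w] it is a positive multiple of -(P / (x u))'.
    Both vanish exactly when P and P' do. *)
Lemma critical_pt b x : 0 < b -> x0 < x ->
  critical_MT0 c Tp T1 T2 (pt b x) <-> dbl x.
Proof.
move=> b0 xx; have qM := pt_MT0 b0 xx; have [M _] := qM.
have u0 : 0 < u x by rewrite u_gt0.
have x_0 := x_gt0 xx.
have Tv v l : has_dirderiv (trT c Tp T1 T2) (pt b x) v l <->
    l = dratfun (- (nu * Tp)) (e1 * T1) (e2 * T2) 0 0 (pt b x) v.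
  apply: has_dirderiv_ratfun => // q' M'; rewrite TE // /ratfun !mul0r addr0 mul0r addr0.
  by rewrite mulNr.
pose gS := dratfun (- (nu / 2%:R)) (e1 * k1 / 4%:R) (e2 * k2 / 4%:R)
   (- (e1 * (1 - k1) / 4%:R)) (- (e2 * (1 - k2) / 4%:R)) (pt b x).
have Sv v l : has_dirderiv (Sfun c) (pt b x) v l <-> l = gS v.
  apply: has_dirderiv_ratfun => // -[[q0 q1] q2] M'; rewrite SE // /ratfun /=.
  by case: M' => /= [q00 [q10 q20]]; field; rewrite !gt_eqF.
(* the direction along the curve of metrics with [beta] constant *)
pose w : R * R * R := (0, - (e1 * e2 * T1 * T2) / u x ^+ 2, 1).
have gS_q : gS (pt b x) = P x / (4%:R * b * x * u x).
  transitivity (- Sfun c (pt b x)); last by rewrite Sfun_pt // mulNr opprK.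
  rewrite SE // /gS /dratfun /pt /= -/nu -/e1 -/e2 -/(u x).
  by field; rewrite !gt_eqF.
have gS_w : gS w = (P x * (u x + nu * Tp * x) - P' x * (x * u x))
    / (4%:R * b ^+ 2 * (x * u x) ^+ 2).
  rewrite /gS /dratfun /pt /w /= -/nu -/e1 -/e2 -/(u x).
  rewrite /P /P' /cubic /cubic' /ca /cb /ccc /cd -/nu -/e1 -/e2.
  have u1 : u x != 0 by rewrite gt_eqF.
  by move: u1; rewrite /u => u1; field; rewrite u1 !gt_eqF.
have T_q : dratfun (- (nu * Tp)) (e1 * T1) (e2 * T2) 0 0 (pt b x) (pt b x) = 0.
  rewrite /dratfun /pt /= -/nu -/e1 -/e2 -/(u x).
  have u1 : u x != 0 by rewrite gt_eqF.
  by move: u1; rewrite /u => u1; field; rewrite u1 !gt_eqF.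
have T_w : dratfun (- (nu * Tp)) (e1 * T1) (e2 * T2) 0 0 (pt b x) w = 0.
  rewrite /dratfun /pt /w /= -/nu -/e1 -/e2 -/(u x).
  by field; rewrite !gt_eqF.
split=> [[_ cr]|[Px P'x]].
  have Sq : gS (pt b x) = 0 by apply/esym/Sv/cr/Tv; rewrite T_q.
  have Sw : gS w = 0 by apply/esym/Sv/cr/Tv; rewrite T_w.
  have Px : P x = 0.
    move/eqP: Sq; rewrite gS_q mulf_eq0 invr_eq0 [X in _ || X]gt_eqF ?den_gt0 // orbF.
    by move/eqP.
  split=> //; move/eqP: Sw; rewrite gS_w Px mul0r sub0r mulf_eq0 invr_eq0 oppr_eq0.
  rewrite [X in _ || X]gt_eqF ?orbF; last by rewrite !mulr_gt0 ?exprn_gt0 ?mulr_gt0.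
  by rewrite mulf_eq0 [X in _ || X]gt_eqF ?orbF ?mulr_gt0 // => /eqP.
split=> // v /Tv Tv0; apply/Sv.
rewrite -/(P x) in Px; rewrite -/(P' x) in P'x.
have Sq : gS (pt b x) = 0 by rewrite gS_q Px mul0r.
have Sw : gS w = 0 by rewrite gS_w Px P'x !mul0r subrr mul0r.
case: v Tv0 => [[v0 v1] v2] Tv0.
(* The coefficients are read off from the beta and alpha_2 components; tangency forces the alpha_1
   component, since tr_g T has nonzero derivative in alpha_1. *)
pose al := v0 / b; pose ga := v2 - al * (b * x).
have v1E : v1 = al * (e1 * T1 * b * x / u x) + ga * (- (e1 * e2 * T1 * T2) / u x ^+ 2).
  apply/eqP; rewrite -subr_eq0.
  have : e1 * T1 / (e1 * T1 * b * x / u x) ^+ 2 * (v1 -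
     (al * (e1 * T1 * b * x / u x) + ga * (- (e1 * e2 * T1 * T2) / u x ^+ 2))) = 0.
    transitivity (- dratfun (- (nu * Tp)) (e1 * T1) (e2 * T2) 0 0 (pt b x) (v0, v1, v2));
      last by rewrite -Tv0 oppr0.
    rewrite /dratfun /pt /= -/nu -/e1 -/e2 -/(u x) /ga /al.
    have u1 : u x != 0 by rewrite gt_eqF.
    by move: u1; rewrite /u => u1; field; rewrite u1 !gt_eqF.
  move/eqP; rewrite mulf_eq0 [X in X || _]gt_eqF //.
  by rewrite divr_gt0 ?exprn_gt0 ?divr_gt0 ?mulr_gt0.
transitivity (al * gS (pt b x) + ga * gS w); first by rewrite Sq Sw !mulr0 addr0.
rewrite /gS /dratfun v1E /pt /w /= -/nu -/e1 -/e2 -/(u x) /ga /al.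
by field; rewrite !gt_eqF.
Qed.

Lemma saddle_pt b x : 0 < b -> x0 < x ->
  saddle_MT0 c Tp T1 T2 (pt b x) <-> dbl x /\ s x = x.
Proof.
move=> b0 xx; rewrite /saddle_MT0 critical_pt // local_max_pt // local_min_pt //.
split=> [[rx [nM nm]]|[rx sx]]; last first.
  by rewrite sx ltxx; split=> //; split=> -[].
by split=> //; case: (ltrgtP (s x) x) => // h; [case: nM|case: nm].
Qed.

(** [B] ignores the scale, so beta = 1 serves as a witness. *)
Lemma exists_pt (A : R * R * R -> Prop) (B : R -> Prop) :
  (forall q, A q -> in_MT0 c Tp T1 T2 q) ->
  (forall b x, 0 < b -> x0 < x -> A (pt b x) <-> B x) ->
  (exists q, A q) <-> exists x, x0 < x /\ B x.
Proof.
move=> AM AB; split=> [[q Aq]|[x [xx Bx]]]; last by exists (pt 1 x); apply/AB.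
have [b0 xx qE] := MT0_pt (AM _ Aq); rewrite qE in Aq.
by exists (q.2 / q.1.1); split=> //; apply/(AB _ _ b0 xx).
Qed.

(** A cubic has at most one multiple root, so both points have the same x and differ by the ratio of
    their beta. *)
Lemma critical_uniq q q' : critical_MT0 c Tp T1 T2 q -> critical_MT0 c Tp T1 T2 q' ->
  exists t : R, 0 < t /\ q' = (t * q.1.1, t * q.1.2, t * q.2).
Proof.
move=> cq cq'; have [b0 xx qE] := MT0_pt cq.1; have [b'0 xx' q'E] := MT0_pt cq'.1.
rewrite qE critical_pt // in cq; rewrite q'E critical_pt // in cq'.
have E := double_root_uniq ca_gt0 cq cq'.
exists (q'.1.1 / q.1.1); rewrite divr_gt0 //; split=> //.
move: (q.2 / q.1.1) (q'.2 / q'.1.1) E xx qE q'E => x _ <- xx.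
case: q b0 {cq cq' xx'} => [[b a1] a2]; case: q' b'0 => [[b' a1'] a2'] /= b'0 b0 [-> ->] [-> ->].
have ux : n%:R * Tp * x - d2%:R * T2 != 0 by rewrite gt_eqF // -/nu -/e2 -/(u x) u_gt0.
by congr (_, _, _); field; rewrite ?ux gt_eqF.
Qed.

End Reduction.

Theorem theorem5p8 (R : realType) (n d1 d2 : nat)
  (c : 'I_(n + d1 + d2) -> 'I_(n + d1 + d2) -> 'rV[R]_(n + d1 + d2))
  (kappa1 kappa2 Tp T1 T2 : R) :
  is_lie_algebra c ->
  simple_lie c ->
  ~ (forall x : 'rV[R]_(n + d1 + d2), x != 0 -> killing c x x < 0) ->
  cartan_decomposition c ->
  k_decomposition_rs2 c ->
  kappa_of c (@k1P n d1 d2) kappa1 ->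
  kappa_of c (@k2P n d1 d2) kappa2 ->
  0 < Tp -> 0 < T1 -> 0 < T2 ->
  let nr : R := n%:R in
  let d1r : R := d1%:R in
  let d2r : R := d2%:R in
  let a := nr * d2r * (1 - kappa2) * Tp in
  let b := d1r ^+ 2 * (1 - kappa1) * T1 - d2r ^+ 2 * (1 - kappa2) * T2
           + 2%:R * nr ^+ 2 * Tp - nr ^+ 2 * kappa1 * Tp ^+ 2 / T1 in
  let cc := - (2%:R * nr * d2r * T2) + 2%:R * nr * d2r * kappa1 * Tp * T2 / T1
            - nr * d2r * kappa2 * Tp in
  let d := - (d2r ^+ 2 * kappa1 * T2 ^+ 2 / T1) + kappa2 * d2r ^+ 2 * T2 in
  let D := 18%:R * a * b * cc * d - 4%:R * b ^+ 3 * d + b ^+ 2 * cc ^+ 2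
           - 4%:R * a * cc ^+ 3 - 27%:R * a ^+ 2 * d ^+ 2 in
  let Rt := - (b / (3%:R * a)) in
  let Rd := (9%:R * a * d - b * cc) / (2%:R * (b ^+ 2 - 3%:R * a * cc)) in
  let Rs := (4%:R * a * b * cc - 9%:R * a ^+ 2 * d - b ^+ 3)
            / (a * (b ^+ 2 - 3%:R * a * cc)) in
  let x0 := d2r * T2 / (nr * Tp) in
  (~ exists q, global_min_MT0 c Tp T1 T2 q) /\
  ((exists q, saddle_MT0 c Tp T1 T2 q) <->
     (D = 0 /\ b ^+ 2 = 3%:R * a * cc /\ x0 < Rt)) /\
  ((exists q, global_max_MT0 c Tp T1 T2 q) <->
     (D = 0 /\ b ^+ 2 != 3%:R * a * cc /\ Rs <= x0 /\ x0 < Rd)) /\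
  ((exists q, local_max_MT0 c Tp T1 T2 q /\ ~ global_max_MT0 c Tp T1 T2 q) <->
     (D = 0 /\ b ^+ 2 != 3%:R * a * cc /\ x0 < Rs /\ Rs < Rd)) /\
  ((exists q, local_min_MT0 c Tp T1 T2 q) <->
     (D = 0 /\ b ^+ 2 != 3%:R * a * cc /\ x0 < Rd /\ Rd < Rs)) /\
  (forall q q', critical_MT0 c Tp T1 T2 q -> critical_MT0 c Tp T1 T2 q' ->
     exists t : R, 0 < t /\ q' = (t * q.1.1, t * q.1.2, t * q.2)).
Proof.
move=> Lc Sc NCc Cc Kc kap1 kap2 Tp0 T10 T20 nr d1r d2r a b cc d D Rt Rd Rs x0.
have n0 := n_gt0 NCc Cc; have d10 := d1_gt0 Lc Kc; have d20 := d2_gt0 Lc Kc.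
have k2lt1 := kappa2_lt1 Lc Sc NCc Cc Kc kap2.
have TE := @trTE R n d1 d2 c Lc Cc Kc Tp T1 T2.
have SE := @SfunE R n d1 d2 c Lc Cc Kc kappa1 kappa2 kap1 kap2.
have a0 : 0 < a by exact: ca_gt0.
have DP x : double_root a b cc d x <->
    (D = 0 /\ b ^+ 2 = 3%:R * a * cc /\ x = Rt /\ coroot a b x = x) \/
    (D = 0 /\ b ^+ 2 != 3%:R * a * cc /\ x = Rd /\ coroot a b x = Rs).
  exact: double_rootP.
have red A B := @exists_pt R n d1 d2 c Tp T1 T2 Tp0 T10 n0 d10 TE A B.
split; first exact: (no_global_min Tp0 T10 T20 n0 d10 d20 k2lt1 TE SE).
split; [|split; [|split; [|split]]].
- rewrite (red _ (fun x => double_root a b cc d x /\ coroot a b x = x)); last first.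
  + by move=> be x be0 xx; exact: (saddle_pt Tp0 T10 T20 n0 d10 d20 k2lt1 TE SE).
  + by move=> q [[]].
  split=> [[x [xx [rx sx]]]|[D0 [bE xR]]].
    have bE := coroot_double a0 rx sx.
    by case: ((DP x).1 rx) => [[D0 [_ [xE _]]]|[_ [/eqP]]//]; rewrite -xE.
  exists Rt; split=> //; split; last exact: (Rt_coroot a0 D0 bE).
  exact: (Rt_double_root a0 D0 bE).
- rewrite (red _ (fun x => double_root a b cc d x /\ coroot a b x <= x0)); last first.
  + by move=> be x be0 xx; exact: (global_max_pt Tp0 T10 T20 n0 d10 d20 k2lt1 TE SE).
  + by move=> q [].
  split=> [[x [xx [rx sx]]]|[D0 [bE [sx xR]]]].
    (* A triple root is excluded: it would give x = s <= x0 < x. *)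
    case: ((DP x).1 rx) => [[_ [_ [_ sE]]]|[D0 [bE [<- <-]]]//].
    by move: xx; rewrite -sE ltNge sx.
  exists Rd; split=> //; rewrite (Rd_coroot a0 D0 bE); split=> //.
  exact: (Rd_double_root a0 D0 bE).
- rewrite (red _ (fun x => (double_root a b cc d x /\ coroot a b x < x) /\
     ~ (double_root a b cc d x /\ coroot a b x <= x0))); last first.
  + move=> be x be0 xx.
    rewrite -(local_max_pt Tp0 T10 T20 n0 d10 d20 k2lt1 TE SE be0 xx).
    by rewrite -(global_max_pt Tp0 T10 T20 n0 d10 d20 k2lt1 TE SE be0 xx).
  + by move=> q [[]].
  split=> [[x [xx [[rx sx] nG]]]|[D0 [bE [sx xR]]]].
    case: ((DP x).1 rx) => [[_ [_ [_ sE]]]|[D0 [bE [xE sE]]]].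
      by rewrite sE ltxx in sx.
    (* For a local maximum, failing to be global means precisely that the third root lies beyond
       [x0]. *)
    rewrite -xE -sE; do !split=> //; rewrite ltNge; apply/negP => h; exact: nG.
  have rx := Rd_double_root a0 D0 bE; have sE := Rd_coroot a0 D0 bE.
  exists Rd; split; first exact: lt_trans sx xR.
  split; first by split=> //; rewrite sE.
  by case=> _; rewrite sE leNgt sx.
- rewrite (red _ (fun x => double_root a b cc d x /\ x < coroot a b x)); last first.
  + by move=> be x be0 xx; exact: (local_min_pt Tp0 T10 T20 n0 d10 d20 k2lt1 TE SE).
  + by move=> q [].
  split=> [[x [xx [rx sx]]]|[D0 [bE [xR sx]]]].
    case: ((DP x).1 rx) => [[_ [_ [_ sE]]]|[D0 [bE [<- <-]]]//].
    by rewrite sE ltxx in sx.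
  exists Rd; split=> //; rewrite (Rd_coroot a0 D0 bE); split=> //.
  exact: (Rd_double_root a0 D0 bE).
exact: (critical_uniq Tp0 T10 T20 n0 d10 d20 k2lt1 TE SE).
Qed.
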